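(* Let $A$ be an algebra of $\mathcal{V}$ such that $K(A)$ is closed under the commutator operation. If $A$ satisfies $(\star)$, then the following are equivalent: (1) $A$ is a congruence $B$-normal algebra; (2) if $\phi$ and $\psi$ are distinct maximal congruences in $A$, then there exists $\alpha\in B(Con(A))$ such that $\alpha\subseteq\phi$ and $\neg\alpha\subseteq\psi$; (3) $A$ is congruence normal and $Max_Z(A)$ is a zero-dimensional space; (4) $A$ is congruence normal and $Max_Z(A)$ is a Boolean space; (5) the family $(D(\alpha)\cap Max(A))_{\alpha\in B(Con(A))}$ is a basis of open sets for $Max_Z(A)$; (6) the map $s_A|_{Max(A)}:Max_Z(A)\rightarrow Sp(A)$ is a homeomorphism; (7) $A$ is congruence normal and $Max_Z(A)$ is a totally disconnected space; (8) if $\phi$ and $\psi$ are distinct maximal congruences in $A$, then there exists $\alpha\in B(Con(A))$ such that $\alpha\subseteq O(\phi)$ and $\neg\alpha\subseteq O(\psi)$.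
   Context: $\mathcal{V}$ is a fixed congruence-modular variety of algebras (of a finite signature) that is semidegenerate: no nontrivial algebra in $\mathcal{V}$ has one-element subalgebras (equivalently, $\nabla_A$ is compact in $Con(A)$ for every $A\in\mathcal{V}$). For $A\in\mathcal{V}$, $Con(A)$ is the complete lattice of congruences of $A$, with least element $\Delta_A$ and greatest element $\nabla_A$; $K(A)$ is the set of compact (= finitely generated) congruences; $Max(A)$ is the set of maximal (proper) congruences. Commutator: $[\cdot,\cdot]=[\cdot,\cdot]_A$ is the (modular) commutator, i.e. the greatest operation on the congruence lattices of members of $\mathcal{V}$ such that for every surjective morphism $f:A\to B$ in $\mathcal{V}$ and all $\alpha,\beta\in Con(A)$: $[\alpha,\beta]_A\subseteq\alpha\cap\beta$ and $[\alpha,\beta]_A\vee Ker(f)=f^{-1}([f(\alpha\vee Ker(f)),f(\beta\vee Ker(f))]_B)$. Put $\alpha^{\perp}=\bigvee\{\gamma\in Con(A)\mid[\alpha,\gamma]=\Delta_A\}$. $B(Con(A))$ is the set of complemented elements of the lattice $Con(A)$; it is a Boolean algebra with complement $\neg\alpha=\alpha^{\perp}$. Iterates: $[\alpha,\alpha]^0=\alpha$, $[\alpha,\beta]^1=[\alpha,\beta]$, $[\alpha,\beta]^{n+1}=[[\alpha,\beta]^n,[\alpha,\beta]^n]$. Condition $(\star)$: for all $\alpha,\beta\in K(A)$ and every integer $n\geq 1$ there is an integer $m\geq 0$ with $[[\alpha,\alpha]^m,[\beta,\beta]^m]\subseteq[\alpha,\beta]^n$. $\phi\in Con(A)\setminus\{\nabla_A\}$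 is prime if $[\alpha,\beta]\subseteq\phi$ implies $\alpha\subseteq\phi$ or $\beta\subseteq\phi$ (for $\alpha,\beta\in Con(A)$); $Spec(A)$ is the set of prime congruences, and $Max(A)\subseteq Spec(A)$. For $\theta\in Con(A)$, $D(\theta)=\{\phi\in Spec(A)\mid\theta\not\subseteq\phi\}$; these are the open sets of the Zariski topology on $Spec(A)$, and $Max_Z(A)$ is $Max(A)$ with the subspace topology. $A$ is congruence normal if for all $\theta,\nu\in Con(A)$ with $\theta\vee\nu=\nabla_A$ there exist $\alpha,\beta\in Con(A)$ with $\theta\vee\alpha=\nu\vee\beta=\nabla_A$ and $[\alpha,\beta]=\Delta_A$. $A$ is congruence $B$-normal if for all $\theta,\nu\in Con(A)$ with $\theta\vee\nu=\nabla_A$ there exist $\alpha,\beta\in B(Con(A))$ with $\theta\vee\alpha=\nu\vee\beta=\nabla_A$ and $[\alpha,\beta]=\Delta_A$. For $\theta\in Con(A)$, $O(\theta)=\bigvee\{\alpha\in Con(A)\mid[\alpha,\beta]=\Delta_A\text{ for some congruence }\beta\not\subseteq\theta\}$. Pierce spectrum: a congruence is regular if it is a join of a family of elements of $B(Con(A))$; a max-regular congruence is a maximal element of the set of proper regular congruences; $Sp(A)$ is the set of max-regular congruences with the topology having as basis the sets $U(\alpha)=\{\chi\in Sp(A)\mid\alpha\not\subseteq\chi\}$, $\alpha\in B(Con(A))$. For $\phi\in Spec(A)$, $s_A(\phi)=\bigvee\{\alpha\in B(Con(A))\mid\alpha\subseteq\phi\}$, which is max-regular, giving $s_A:Spec(A)\to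 Sp(A)$. A space is zero-dimensional if it has a basis of clopen sets; Boolean if it is compact, Hausdorff and zero-dimensional; totally disconnected if its only nonempty connected subsets are single points. *)

(* Defs.v *)
From HB Require Import structures.
From mathcomp Require Import all_boot all_order.
From mathcomp Require Import all_classical topology.

Set Implicit Arguments.
Unset Strict Implicit.
Unset Printing Implicit Defensive.

Local Open Scope classical_set_scope.

Record signature := Signature { symbol : finType; arity : symbol -> nat }.

(* As usual in universal algebra, carriers are nonempty. *)
Record algebra (sg : signature) := Algebra {
  carrier :> Type;
  op : forall s : symbol sg, ('I_(arity s) -> carrier) -> carrier;
  carrier_nonempty : inhabited carrier }.
Arguments op {sg a} s _.

Section Algebras.
Context {sg : signature}.
Implicit Types A B : algebra sg.

Record hom A B := Hom {
  hom_fun :> A -> B;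
  homP : forall (s : symbol sg) (x : 'I_(arity s) -> A),
    hom_fun (op s x) = op s (hom_fun \o x) }.

Definition subuniverse A (X : set A) :=
  forall (s : symbol sg) (x : 'I_(arity s) -> A),
    (forall i, X (x i)) -> X (op s x).

Definition nontrivial A := exists x y : A, x <> y.

Lemma prod_nonempty (I : Type) (F : I -> algebra sg) :
  inhabited (forall i, F i).
Proof.
have h i : exists x : F i, True by have [x] := carrier_nonempty (F i); exists x.
by constructor=> i; exact: projT1 (cid (h i)).
Qed.

Definition prod_algebra (I : Type) (F : I -> algebra sg) : algebra sg :=
  @Algebra sg (forall i, F i) (fun s x i => op s (fun k => x k i))
    (prod_nonempty F).

(* Congruences, as sets of pairs; for alpha, beta : congruence A, the order of
   the lattice Con(A) is the inclusion alpha `<=` beta. *)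
Record congruence A := Congruence {
  cong_set :> set (A * A);
  cong_refl : forall x, cong_set (x, x);
  cong_sym : forall x y, cong_set (x, y) -> cong_set (y, x);
  cong_trans : forall x y z,
    cong_set (x, y) -> cong_set (y, z) -> cong_set (x, z);
  cong_op : forall (s : symbol sg) (x y : 'I_(arity s) -> A),
    (forall i, cong_set (x i, y i)) -> cong_set (op s x, op s y) }.

Lemma congruence_ext A (alpha beta : congruence A) :
  alpha = beta :> set (A * A) -> alpha = beta.
Proof.
case: alpha beta => [a r1 s1 t1 o1] [b r2 s2 t2 o2] /= ab; subst b.
by congr Congruence; exact: Prop_irrelevance.
Qed.

Section Constructions.
Variable A : algebra sg.
Implicit Types alpha beta theta : congruence A.

Definition Delta : congruence A.
Proof.
refine (@Congruence A [set p | p.1 = p.2] _ _ _ _) => //=.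
- by move=> x y z -> ->.
- by move=> s x y xy; congr op; apply/funext.
Defined.

Definition Nabla : congruence A.
Proof. by refine (@Congruence A setT _ _ _ _). Defined.

Definition cong_meet alpha beta : congruence A.
Proof.
refine (@Congruence A (alpha `&` beta) _ _ _ _).
- by move=> x; split; exact: cong_refl.
- by move=> x y [? ?]; split; exact: cong_sym.
- by move=> x y z [a1 b1] [a2 b2]; split; [exact: cong_trans a1 a2|
    exact: cong_trans b1 b2].
- by move=> s x y xy; split; apply: cong_op => i; have [] := xy i.
Defined.

Definition cong_gen (R : set (A * A)) : congruence A.
Proof.
refine (@Congruence A
  (\bigcap_(theta in [set theta : congruence A | R `<=` theta]) theta) _ _ _ _).
- by move=> x theta _; exact: cong_refl.
- by move=> x y xy theta Rt; apply: cong_sym; exact: xy.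
- by move=> x y z xy yz theta Rt; apply: cong_trans (xy _ Rt) (yz _ Rt).
- by move=> s x y xy theta Rt; apply: cong_op => i; exact: xy.
Defined.

Definition cong_sup (S : set (congruence A)) : congruence A :=
  cong_gen (\bigcup_(alpha in S) alpha).

Definition cong_join alpha beta : congruence A := cong_gen (alpha `|` beta).

End Constructions.

Arguments Delta {A}.
Arguments Nabla {A}.

Definition cong_preimage A B (f : hom A B) (theta : congruence B) : congruence A.
Proof.
refine (@Congruence A [set p | cong_set theta (f p.1, f p.2)] _ _ _ _) => /=.
- by move=> x; exact: cong_refl.
- by move=> x y; exact: cong_sym.
- by move=> x y z; exact: cong_trans.
- by move=> s x y xy; rewrite !homP; exact: cong_op.
Defined.

(* For f surjective and Ker f `<=` theta this is the set-theoretic image of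
   theta, see cong_imageE. *)
Definition cong_image A B (f : hom A B) (theta : congruence A) : congruence B :=
  cong_gen [set (f p.1, f p.2) | p in (theta : set (A * A))].

Definition Ker A B (f : hom A B) : congruence A := cong_preimage f Delta.

Definition surjective (A B : Type) (f : A -> B) := forall y, exists x, f x = y.

Lemma cong_imageE A B (f : hom A B) (theta : congruence A) :
  surjective f -> Ker f `<=` theta ->
  cong_image f theta = [set (f p.1, f p.2) | p in (theta : set (A * A))]
    :> set (B * B).
Proof.
move=> fs kt; set R := [set _ | _ in _].
have RP x y : R (f x, f y) -> cong_set theta (x, y).
  case=> -[a b] /= ab [fa fb].
  apply: (@cong_trans _ theta _ a); first by apply: kt => /=.
  by apply: (@cong_trans _ theta _ b) => //; apply: kt => /=.
suff [rho rhoE] : exists rho : congruence B, rho = R :> set (B * B).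
  apply/seteqP; split=> [p|p Rp rho']; last exact.
  by move=> /(_ rho); rewrite /= rhoE; apply.
unshelve eexists (@Congruence B R _ _ _ _) => //.
- by move=> y; have [x <-] := fs y; exists (x, x) => //; exact: cong_refl.
- by move=> x y [[a b] ab [<- <-]]; exists (b, a) => //; exact: cong_sym.
- move=> x y z [[a b] ab [<- <-]] [[c d] cd [/= cb <-]].
  exists (a, d) => //; apply: (@cong_trans _ theta _ b) => //.
  by apply: (@cong_trans _ theta _ c) => //; apply: kt => /=.
- move=> s x y xy.
  pose g i := projT1 (cid (fs (x i))); pose h i := projT1 (cid (fs (y i))).
  have gx : x = f \o g.
    by apply/funext => i; rewrite /= /g; case: cid.
  have hy : y = f \o h.
    by apply/funext => i; rewrite /= /h; case: cid.
  exists (op s g, op s h) => /=; last by rewrite !homP gx hy.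
  by apply: cong_op => i; apply: RP; have := xy i; rewrite gx hy.
Qed.

Section Lattice.
Variable A : algebra sg.
Implicit Types alpha beta gamma : congruence A.

Definition modular_con := forall alpha beta gamma, alpha `<=` gamma ->
  cong_meet (cong_join alpha beta) gamma =
  cong_join alpha (cong_meet beta gamma).

Definition compact_cong : set (congruence A) :=
  [set alpha | forall S : set (congruence A), alpha `<=` cong_sup S ->
    exists F : set (congruence A),
      [/\ finite_set F, F `<=` S & alpha `<=` cong_sup F]].

Definition maximal_cong : set (congruence A) :=
  [set phi | phi <> Nabla /\
    forall theta : congruence A,
      theta <> Nabla -> phi `<=` theta -> theta = phi].

(* The complemented elements of Con(A). *)
Definition boolean_cong : set (congruence A) :=
  [set alpha | exists beta : congruence A,
    cong_join alpha beta = Nabla /\ cong_meet alpha beta = Delta].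

Definition regular_cong : set (congruence A) :=
  [set chi | exists2 S : set (congruence A),
    S `<=` boolean_cong & chi = cong_sup S].

Definition max_regular_cong : set (congruence A) :=
  [set chi | [/\ regular_cong chi, chi <> Nabla &
    forall theta : congruence A,
      regular_cong theta -> theta <> Nabla -> chi `<=` theta -> theta = chi]].

(* s_A; its values at prime congruences are max-regular. *)
Definition s_cong (phi : congruence A) : congruence A :=
  cong_sup [set alpha | boolean_cong alpha /\ alpha `<=` phi].

HB.instance Definition _ := gen_eqMixin (congruence A).
HB.instance Definition _ := gen_choiceMixin (congruence A).
HB.instance Definition _ := isPointed.Build (congruence A) Nabla.

(* The Pierce spectrum, with the topology generated by the sets Sp_U alpha for
   alpha complemented. When A is in a semidegenerate congruence-modular variety,
   Sp_U alpha `&` Sp_U beta = Sp_U (cong_meet alpha beta) with cong_meet alpha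
   beta complemented, so these sets form a basis and not merely a subbasis. *)
Definition Sp : Type := set_type max_regular_cong.

Definition Sp_cong (chi : Sp) : congruence A := \val chi.

Definition Sp_U (alpha : congruence A) : set Sp :=
  [set chi | ~ alpha `<=` Sp_cong chi].

HB.instance Definition _ := Choice.on Sp.
HB.instance Definition _ := isSubBaseTopological.Build Sp boolean_cong Sp_U.

End Lattice.
End Algebras.

Arguments Delta {sg A}.
Arguments Nabla {sg A}.

(* Varieties: classes closed under homomorphic images, (isomorphic copies of)
   subalgebras and products. *)
Record variety (sg : signature) := Variety {
  in_variety :> algebra sg -> Prop;
  variety_H : forall (A B : algebra sg) (f : hom A B),
    surjective f -> in_variety A -> in_variety B;
  variety_S : forall (A B : algebra sg) (f : hom A B),
    injective f -> in_variety B -> in_variety A;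
  variety_P : forall (I : Type) (F : I -> algebra sg),
    (forall i, in_variety (F i)) -> in_variety (prod_algebra F) }.

Record member (sg : signature) (V : variety sg) := Member {
  member_algebra :> algebra sg;
  memberP : V member_algebra }.

Section Varieties.
Context {sg : signature}.
Variable V : variety sg.

Definition congruence_modular := forall A : member V, modular_con A.

Definition semidegenerate := forall A : member V,
  nontrivial A -> ~ exists x : A, subuniverse [set x].

Definition cong_operation :=
  forall A : member V, congruence A -> congruence A -> congruence A.

Definition commutator_operation (C : cong_operation) :=
  (forall (A : member V) (alpha beta : congruence A),
     C A alpha beta `<=` alpha `&` beta) /\
  (forall (A B : member V) (f : hom A B), surjective f ->
     forall alpha beta : congruence A,
       cong_join (C A alpha beta) (Ker f) =
       cong_preimage f (C B (cong_image f (cong_join alpha (Ker f)))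
                            (cong_image f (cong_join beta (Ker f))))).

Definition greatest_commutator_operation (C : cong_operation) :=
  commutator_operation C /\
  forall C', commutator_operation C' ->
    forall (A : member V) (alpha beta : congruence A),
      C' A alpha beta `<=` C A alpha beta.

(* The greatest commutator operation, which exists when V is congruence
   modular; the meet is a placeholder for the other varieties. *)
Definition comm : cong_operation :=
  match pselect (exists C, greatest_commutator_operation C) with
  | left ex => projT1 (cid ex)
  | right _ => fun A => @cong_meet sg A
  end.

Lemma comm_sub (A : member V) (alpha beta : congruence A) :
  comm alpha beta `<=` alpha `&` beta.
Proof.
rewrite /comm; case: pselect => [ex|_]; last by [].
by have [[subI _] _] := projT2 (cid ex); exact: subI.
Qed.

End Varieties.

Section Commutator.
Context {sg : signature} {V : variety sg}.
Variable A : member V.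
Implicit Types alpha beta theta nu : congruence A.

Definition perp alpha : congruence A :=
  cong_sup [set gamma : congruence A | comm alpha gamma = Delta].

(* [alpha, beta]^n; the value at n = 0 is only meant for alpha = beta. *)
Fixpoint comm_iter alpha beta (n : nat) : congruence A :=
  match n with
  | 0 => alpha
  | m.+1 =>
    if m is 0 then comm alpha beta
    else comm (comm_iter alpha beta m) (comm_iter alpha beta m)
  end.

Definition compact_comm_closed := forall alpha beta,
  compact_cong alpha -> compact_cong beta -> compact_cong (comm alpha beta).

Definition star_condition := forall alpha beta,
  compact_cong alpha -> compact_cong beta ->
  forall n, (1 <= n)%N -> exists m : nat,
    comm (comm_iter alpha alpha m) (comm_iter beta beta m)
      `<=` comm_iter alpha beta n.

Definition prime_cong : set (congruence A) :=
  [set phi | phi <> Nabla /\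
    forall alpha beta, comm alpha beta `<=` phi ->
      alpha `<=` phi \/ beta `<=` phi].

Definition congruence_normal := forall theta nu, cong_join theta nu = Nabla ->
  exists alpha beta, [/\ cong_join theta alpha = Nabla,
    cong_join nu beta = Nabla & comm alpha beta = Delta].

Definition congruence_B_normal := forall theta nu, cong_join theta nu = Nabla ->
  exists alpha beta, [/\ boolean_cong alpha, boolean_cong beta,
    cong_join theta alpha = Nabla, cong_join nu beta = Nabla &
    comm alpha beta = Delta].

Definition O_cong theta : congruence A :=
  cong_sup [set alpha : congruence A |
    exists2 beta : congruence A, ~ beta `<=` theta & comm alpha beta = Delta].

Definition Spec : Type := set_type prime_cong.

Definition Spec_D theta : set Spec := [set phi : Spec | ~ theta `<=` \val phi].

Definition Spec_open : set_system Spec := range Spec_D.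

Lemma Spec_openT : Spec_open setT.
Proof.
exists Nabla => //; apply/seteqP; split=> // phi _ /= N.
have [phiN _] := set_mem (valP phi).
by apply: phiN; apply/congruence_ext/seteqP; split.
Qed.

Lemma Spec_openI : setI_closed Spec_open.
Proof.
move=> _ _ [alpha _ <-] [beta _ <-]; exists (comm alpha beta) => //.
apply/seteqP; split=> phi /=.
- by move=> nab; split=> ab; apply: nab => p /comm_sub [? ?]; exact: ab.
- by have [_ phiP] := set_mem (valP phi); move=> [na nb] /phiP[].
Qed.

Lemma Spec_open_bigU (I : Type) (f : I -> set Spec) :
  (forall i, Spec_open (f i)) -> Spec_open (\bigcup_i f i).
Proof.
move=> fo; have fo' i : exists theta, Spec_D theta = f i.
  by have [theta _ <-] := fo i; exists theta.
pose t i := projT1 (cid (fo' i)).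
have tE i : f i = Spec_D (t i) by rewrite /t; case: cid.
exists (cong_sup (range t)) => //; apply/seteqP; split=> phi /=.
- move=> nphi; apply: contrapT => np; apply: nphi => p; apply.
  move=> q [_ [i _ <-] tq]; apply: contrapT => nq; apply: np.
  by exists i => //; rewrite tE => tphi; apply: nq; exact: tphi.
- move=> [i _]; rewrite tE => ntphi sphi; apply: ntphi => p tp.
  by apply: sphi => theta; apply; exists (t i).
Qed.

HB.instance Definition _ := Choice.on Spec.
HB.instance Definition _ :=
  isOpenTopological.Build Spec Spec_openT Spec_openI Spec_open_bigU.

(* Max_Z(A), a subtype of Spec(A) because maximal congruences are prime in a
   semidegenerate congruence-modular variety; its topology is the one of
   subtype_topology.v, induced by Spec(A). *)
Definition Max_Z : topologicalType :=
  set_type [set phi : Spec | maximal_cong (\val phi)].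

Definition Max_cong (phi : Max_Z) : congruence A := \val (\val phi).

Definition Max_D theta : set Max_Z := [set phi | Spec_D theta (\val phi)].

End Commutator.

(* The library's zero_dimensional is a weaker separation property. *)
Definition clopen_basis_space (T : topologicalType) :=
  exists2 B : set (set T), B `<=` clopen & basis B.

Definition boolean_space (T : topologicalType) :=
  [/\ compact [set: T], hausdorff_space T & clopen_basis_space T].

Definition homeomorphism (S T : topologicalType) (f : S -> T) :=
  continuous f /\
  exists g : T -> S, [/\ cancel f g, cancel g f & continuous g].

(* Main.v *)
From Stdlib Require Import Relation_Operators.
Require Import Defs.
From mathcomp Require Import all_boot all_order.
From mathcomp Require Import all_classical topology.

Set Implicit Arguments.
Unset Strict Implicit.
Unset Printing Implicit Defensive.

Local Open Scope classical_set_scope.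

(** The first half of the proof makes the commutator concrete. For congruences
    alpha and beta of A, view alpha as a subalgebra of A * A and let Delta be
    the congruence that the pairs ((u, u), (v, v)), u beta v, generate on it
    ([dcong]). The congruence [modular_comm] generated by the pairs (z, w) such
    that (x, z) Delta (x, w) for some x turns out to be the greatest commutator
    operation, so that it is [comm] ([commE]). Modularity is used in the form
    of the Shifting Lemma ([shifting]), applied in the algebras alpha and beta.
    It shows that the inclusion of [alpha, beta] in delta amounts to a term
    condition on 2 x 2 matrices whose rows are in beta and whose columns are in
    alpha. This condition is visibly additive in alpha, and the Shifting Lemma
    makes it symmetric; compatibility with surjections follows. Conversely any
    commutator operation lies below [modular_comm]: evaluate it in the algebra
    alpha, at the kernel of the first projection and at Delta, and push the
    result forward along the second projection.

    Semidegeneracy enters through [idempotent_class_Nabla]: a congruence of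
    which some class is a subalgebra gives a quotient with a one-element
    subalgebra, hence is the total congruence. Applied to the congruence
    generated by the finitely many pairs (op s (a, ..., a), a) it makes Nabla
    compact; applied to Delta for beta = Nabla it gives [alpha, Nabla] = alpha.

    From then on Con(A) can be handled like the lattice of ideals of a
    commutative ring: maximal congruences are prime, each proper congruence
    lies below one of them, and the complemented congruences play the role of
    idempotents.

    Every condition of the theorem is compared with [boolean_separated], which
    separates distinct maximal congruences by a complemented congruence and its
    complement. From this separation compactness of Nabla yields
    [separated_below]: a congruence that is not below the maximal phi contains
    a complemented one that is not below phi. That is the basis property, and
    another appeal to compactness gives B-normality. For the Pierce spectrum
    and for the congruences O(phi) it is enough that a prime congruence
    contains exactly one of a complemented congruence and its complement. As
    for the topological conditions, congruence normality makes the compact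
    space of maximal congruences Hausdorff, and in a compact Hausdorff space
    total disconnectedness provides enough clopen sets. It remains to lift a
    clopen set of maximal congruences to a complemented congruence
    ([normal_clopen]). Such a set and its complement are given by comaximal
    theta and nu, one of which lies below each maximal congruence. The
    congruences alpha and beta provided by normality, with theta v alpha =
    Nabla = nu v beta and [alpha, beta] = Delta, are then comaximal too,
    because each maximal congruence misses one of them; so they complement each
    other. *)

(** * Congruence lattices and the Shifting Lemma *)

Local Notation "x ~[ theta ] y" := (cong_set theta (x, y))
  (at level 70, theta at level 200, format "x  ~[ theta ]  y").

Section CongruenceLattice.
Context {sg : signature} (A : algebra sg).
Implicit Types (alpha beta gamma theta : congruence A) (S : set (congruence A)).

Lemma cong_anti alpha beta :
  alpha `<=` beta -> beta `<=` alpha -> alpha = beta.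
Proof. by move=> ab ba; apply/congruence_ext/seteqP; split. Qed.

Lemma eq_cong theta x y : x = y -> x ~[theta] y.
Proof. by move=> ->; exact: cong_refl. Qed.

Lemma Delta_sub theta : Delta `<=` theta.
Proof. by move=> [x y] /= ->; exact: cong_refl. Qed.

Lemma Nabla_eq theta : Nabla `<=` theta -> theta = Nabla.
Proof. by move=> h; exact: cong_anti. Qed.

Lemma Delta_eq theta : theta `<=` Delta -> theta = Delta.
Proof. by move=> h; apply: cong_anti => //; exact: Delta_sub. Qed.

Lemma sub_gen (R : set (A * A)) : R `<=` cong_gen R.
Proof. by move=> p Rp theta; exact. Qed.

Lemma gen_sub (R : set (A * A)) theta : R `<=` theta -> cong_gen R `<=` theta.
Proof. by move=> Rt p; exact. Qed.

Lemma sub_joinl alpha beta : alpha `<=` cong_join alpha beta.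
Proof. by move=> p ap; apply: sub_gen; left. Qed.

Lemma sub_joinr alpha beta : beta `<=` cong_join alpha beta.
Proof. by move=> p bp; apply: sub_gen; right. Qed.

Lemma join_sub alpha beta theta :
  alpha `<=` theta -> beta `<=` theta -> cong_join alpha beta `<=` theta.
Proof. by move=> at_ bt; apply: gen_sub => p [/at_|/bt]. Qed.

Lemma sub_sup S alpha : S alpha -> alpha `<=` cong_sup S.
Proof. by move=> Sa p ap; apply: sub_gen; exists alpha. Qed.

Lemma sup_sub S theta :
  (forall alpha, S alpha -> alpha `<=` theta) -> cong_sup S `<=` theta.
Proof. by move=> St; apply: gen_sub => p [alpha /St]; exact. Qed.

Lemma joinE alpha beta : cong_join alpha beta = cong_sup [set alpha; beta].
Proof.
apply: cong_anti.
- by apply: join_sub; apply: sub_sup; [left|right].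
- by apply: sup_sub => _ [->|->]; [exact: sub_joinl|exact: sub_joinr].
Qed.

Lemma joinC alpha beta : cong_join alpha beta = cong_join beta alpha.
Proof.
by apply: cong_anti; apply: join_sub; (exact: sub_joinl || exact: sub_joinr).
Qed.

Lemma join_mono alpha beta alpha' beta' : alpha `<=` alpha' ->
  beta `<=` beta' -> cong_join alpha beta `<=` cong_join alpha' beta'.
Proof.
move=> aa bb; apply: join_sub.
- by apply: subset_trans aa _; exact: sub_joinl.
- by apply: subset_trans bb _; exact: sub_joinr.
Qed.

(** A union of congruences is not compatible with the operations, but it has
    this property, which is enough for its transitive closure to be compatible.
    *)
Definition one_place_compatible (R : set (A * A)) :=
  forall (s : symbol sg) (i : 'I_(arity s)) (x y : 'I_(arity s) -> A),
    R (x i, y i) -> (forall j, j != i -> x j = y j) -> R (op s x, op s y).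

Lemma clos_op (R : set (A * A)) : one_place_compatible R ->
  let T x y := clos_refl_trans A (fun x y => R (x, y)) x y in
  forall (s : symbol sg) (x y : 'I_(arity s) -> A),
    (forall i, T (x i) (y i)) -> T (op s x) (op s y).
Proof.
move=> RP T s x y Txy.
pose upd (u : 'I_(arity s) -> A) i a j := if j == i then a else u j.
have updT u i a b : T a b -> T (op s (upd u i a)) (op s (upd u i b)).
  elim=> {a b} [a b ab|a|a b c _ ab _ bc].
  - apply: rt_step; apply: (RP s i); rewrite /upd ?eqxx //.
    by move=> j /negPf ->.
  - exact: rt_refl.
  - exact: rt_trans ab bc.
(* The coordinates are changed from x to y one at a time. *)
pose z k (i : 'I_(arity s)) := if (i < k)%N then y i else x i.
have zT k : (k <= arity s)%N -> T (op s x) (op s (z k)).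
  elim: k => [_|k IH kn]; first exact: rt_refl.
  apply: rt_trans (IH (ltnW kn)) _; pose i := Ordinal kn.
  have -> : z k = upd (z k) i (x i).
    by apply/funext => j; rewrite /upd; case: eqP => // ->; rewrite /z /= ltnn.
  have -> : z k.+1 = upd (z k) i (y i).
    apply/funext => j; rewrite /upd /z ltnS leq_eqVlt -val_eqE /=.
    by case: eqP => //= jk; congr y; apply: val_inj.
  exact: updT.
have -> : y = z (arity s) by apply/funext => i; rewrite /z ltn_ord.
exact: zT.
Qed.

(** The transitive closure of such an R is already a congruence, so that a
    property preserved by R is preserved along chains. This replaces every
    computation with terms: joins of congruences and the congruences [dcong]
    are only ever met through the sets that they saturate. *)
Lemma gen_saturated (R : set (A * A)) (U : set A) :
  (forall x y, R (x, y) -> R (y, x)) -> one_place_compatible R ->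
  (forall x y, R (x, y) -> U x -> U y) ->
  forall x y, x ~[cong_gen R] y -> U x -> U y.
Proof.
move=> Rsym RP RU.
pose C := [set p : A * A | clos_refl_trans A (fun x y => R (x, y)) p.1 p.2].
have [T TE] : exists T : congruence A, T = C :> set (A * A).
  unshelve eexists (@Congruence sg A C _ _ _ _) => //; rewrite /C /=.
  - by move=> x; exact: rt_refl.
  - move=> x y; elim=> {x y} [x y /Rsym xy|x|x y z _ xy _ yz].
    + exact: rt_step.
    + exact: rt_refl.
    + exact: rt_trans yz xy.
  - by move=> x y z; exact: rt_trans.
  - exact: clos_op.
have RT : R `<=` T by rewrite TE => -[x y] Rxy; exact: rt_step.
move=> x y /(gen_sub RT); rewrite TE /C /=.
elim=> {x y} [x y Rxy|//|x y z _ xy _ yz Ux]; first exact: RU.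
by apply: yz; exact: xy.
Qed.

Lemma sup_saturated S (U : set A) :
  (forall theta x y, S theta -> x ~[theta] y -> U x -> U y) ->
  forall x y, x ~[cong_sup S] y -> U x -> U y.
Proof.
move=> SU; apply: gen_saturated.
- by move=> x y [theta St xy]; exists theta => //; exact: cong_sym.
- move=> s i x y [theta St xy] h; exists theta => //; apply: cong_op => j.
  by have [->//|/h ->] := eqVneq j i; exact: cong_refl.
- by move=> x y [theta St xy]; exact: SU St xy.
Qed.

Lemma join_saturated alpha beta (U : set A) :
  (forall x y, x ~[alpha] y -> U x -> U y) ->
  (forall x y, x ~[beta] y -> U x -> U y) ->
  forall x y, x ~[cong_join alpha beta] y -> U x -> U y.
Proof.
move=> aU bU; rewrite joinE; apply: sup_saturated => theta x y.
by case=> ->; [exact: aU|exact: bU].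
Qed.

(** In the rectangle x, y, v, u with sides in alpha and beta, the pair (x, y)
    lies in alpha /\ (beta v (alpha /\ gamma)), which by the modular law is
    (alpha /\ beta) v (alpha /\ gamma). *)
Lemma shifting : modular_con A ->
  forall alpha beta gamma (x y u v : A),
    cong_meet alpha beta `<=` gamma ->
    x ~[alpha] y -> u ~[alpha] v -> x ~[beta] u -> y ~[beta] v ->
    u ~[gamma] v -> x ~[gamma] y.
Proof.
move=> Amod a b c x y u v abc xy uv xu yv cuv.
have aca : cong_meet a c `<=` a by move=> p [].
have h := Amod _ b _ aca.
have : x ~[cong_meet (cong_join (cong_meet a c) b) a] y.
  split=> //; apply: cong_trans (sub_joinr xu) _.
  apply: cong_trans (_ : v ~[_] y); first exact: sub_joinl.
  by apply: sub_joinr; exact: cong_sym.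
rewrite h; apply: join_sub => p [p1 p2] //.
by apply: abc; split.
Qed.

End CongruenceLattice.

Section Homs.
Context {sg : signature} (A B : algebra sg) (f : hom A B).

Lemma cong_image_sub (alpha : congruence A) (theta : congruence B) :
  alpha `<=` cong_preimage f theta -> cong_image f alpha `<=` theta.
Proof. by move=> at_; apply: gen_sub => _ [[x y] /at_ ? <-]. Qed.

Lemma cong_image_in (alpha : congruence A) x y :
  x ~[alpha] y -> f x ~[cong_image f alpha] f y.
Proof. by move=> xy; apply: sub_gen; exists (x, y). Qed.

End Homs.

(** * A congruence as a subalgebra of the square *)

Section PairAlgebra.
Context {sg : signature} {A : algebra sg} (theta : congruence A).

Definition pair_alg : algebra sg.
Proof.
refine (@Algebra sg {p : A * A | cong_set theta p}
  (fun s x => exist _ (op s (fun i => (sval (x i)).1),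
                       op s (fun i => (sval (x i)).2)) _) _).
- by apply: cong_op => i; case: (x i) => -[].
- have [a] := carrier_nonempty A; constructor; exists (a, a).
  exact: cong_refl.
Defined.

Definition pr1 : hom pair_alg A :=
  @Hom sg pair_alg A (fun p => (sval p).1) (fun _ _ => erefl).

Definition pr2 : hom pair_alg A :=
  @Hom sg pair_alg A (fun p => (sval p).2) (fun _ _ => erefl).

Definition mkpair x y (xy : x ~[theta] y) : pair_alg := exist _ (x, y) xy.

Lemma pair_ext (p q : pair_alg) : pr1 p = pr1 q -> pr2 p = pr2 q -> p = q.
Proof.
case: p q => [[a b] ab] [[c d] cd] /= ac bd; subst c d.
by congr exist; exact: Prop_irrelevance.
Qed.

Lemma pairP (p : pair_alg) : pr1 p ~[theta] pr2 p.
Proof. by case: p => -[]. Qed.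

Definition diag : hom A pair_alg.
Proof.
refine (@Hom sg A pair_alg (fun x => mkpair (cong_refl theta x)) _).
by move=> s x; exact: pair_ext.
Defined.

Definition swap : hom pair_alg pair_alg.
Proof.
refine (@Hom sg pair_alg pair_alg (fun p => mkpair (cong_sym (pairP p))) _).
by move=> s x; exact: pair_ext.
Defined.

Lemma pr2_surj : surjective pr2.
Proof. by move=> x; exists (diag x). Qed.

(** This is the congruence usually written Delta_(theta, beta). Its pairs are
    best seen as 2 x 2 matrices, with columns in theta and rows in beta. *)
Definition dcong (beta : congruence A) : congruence pair_alg :=
  cong_gen [set (diag p.1, diag p.2) | p in (beta : set (A * A))].

Lemma dcong_diag beta u v : u ~[beta] v -> diag u ~[dcong beta] diag v.
Proof. by move=> uv; apply: sub_gen; exists (u, v). Qed.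

Lemma dcong_sub beta (Theta : congruence pair_alg) :
  (forall u v, u ~[beta] v -> diag u ~[Theta] diag v) -> dcong beta `<=` Theta.
Proof. by move=> bT; apply: gen_sub => _ [[u v] uv <-]; exact: bT. Qed.

Lemma dcong_pr1 beta p q : p ~[dcong beta] q -> pr1 p ~[beta] pr1 q.
Proof. exact: (@dcong_sub _ (cong_preimage pr1 beta)). Qed.

Lemma dcong_pr2 beta p q : p ~[dcong beta] q -> pr2 p ~[beta] pr2 q.
Proof. exact: (@dcong_sub _ (cong_preimage pr2 beta)). Qed.

Lemma dcong_swap beta p q : p ~[dcong beta] q -> swap p ~[dcong beta] swap q.
Proof.
apply: (@dcong_sub _ (cong_preimage swap (dcong beta))) => u v uv.
have swap_diag w : swap (diag w) = diag w by exact: pair_ext.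
have : swap (diag u) ~[dcong beta] swap (diag v).
  by rewrite !swap_diag; exact: dcong_diag.
by [].
Qed.

End PairAlgebra.

Arguments pr1 {sg A theta}.
Arguments pr2 {sg A theta}.
Arguments swap {sg A theta}.

Definition pair_map (sg : signature) (A B : algebra sg) (f : hom A B)
    (theta : congruence A) (theta' : congruence B)
    (ff : theta `<=` cong_preimage f theta') :
  hom (pair_alg theta) (pair_alg theta').
Proof.
refine (@Hom sg (pair_alg theta) (pair_alg theta')
  (fun p => mkpair (ff _ (pairP p) : f (pr1 p) ~[theta'] f (pr2 p))) _).
by move=> s x; apply: pair_ext; rewrite /= homP.
Defined.

Lemma pair_in_variety (sg : signature) (V : variety sg) (A : member V)
  (theta : congruence A) : V (pair_alg theta).
Proof.
pose F (b : bool) : algebra sg := A.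
pose e (p : pair_alg theta) : prod_algebra F :=
  fun b => if b then pr1 p else pr2 p.
have eP s (x : 'I_(arity s) -> pair_alg theta) : e (op s x) = op s (e \o x).
  by apply/funext => -[].
apply: (@variety_S _ V _ _ (Hom eP)); last first.
  by apply: variety_P => b; exact: memberP.
move=> p q /= epq; apply: pair_ext; first exact: (congr1 (fun h => h true) epq).
exact: (congr1 (fun h => h false) epq).
Qed.

Definition pair_member (sg : signature) (V : variety sg) (A : member V)
  (theta : congruence A) : member V := Member (pair_in_variety theta).

(** * The modular commutator *)

Section Centrality.
Context {sg : signature} (V : variety sg) (V_modular : congruence_modular V).

Section OneAlgebra.
Variable A : member V.
Implicit Types (alpha beta delta : congruence A) (S : set (congruence A)).

(** This condition and [term_condition] both require that matrices with columns
    in alpha and rows in beta have their second row in delta if their first row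
    is trivial, respectively in delta. They differ in the direction in which
    matrices are composed: horizontally here, vertically in [term_condition].
    The Shifting Lemma makes them equivalent ([centralizesE]), which is why
    centrality is symmetric in alpha and beta. *)
Definition centralizes alpha beta delta :=
  forall p q : pair_alg alpha, p ~[dcong alpha beta] q -> pr1 p = pr1 q ->
    pr2 p ~[delta] pr2 q.

Definition term_condition alpha beta delta :=
  forall p q : pair_alg beta, p ~[dcong beta alpha] q ->
    pr1 p ~[delta] pr2 p -> pr1 q ~[delta] pr2 q.

Let pair_modular alpha : modular_con (pair_alg alpha) :=
  @V_modular (pair_member alpha).

(** The rectangle is p = (x, z), q = (y, w), (x, x), (y, y): its vertical sides
    lie in the kernel of the first projection, its horizontal sides in [dcong
    alpha beta], because x beta y. Centrality says that the meet of these two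
    congruences lies below the lift of delta along the second projection. *)
Lemma centralizes_shift alpha beta delta (p q : pair_alg alpha) :
  centralizes alpha beta delta -> p ~[dcong alpha beta] q ->
  pr1 p ~[delta] pr1 q -> pr2 p ~[delta] pr2 q.
Proof.
move=> cabd pq d1.
apply: (@shifting _ _ (@pair_modular _) (dcong alpha beta) (Ker pr1)
  (cong_preimage pr2 delta) p q
  (diag alpha (pr1 p)) (diag alpha (pr1 q))) => //.
- by move=> [p' q'] [/= pq' k]; exact: cabd pq' k.
- by apply: dcong_diag; exact: dcong_pr1 pq.
Qed.

(** The generators of [dcong beta alpha] belong to the relation R given by the
    transposed [dcong alpha beta], and by [centralizes_shift] each step of R
    preserves being in delta. *)
Lemma centralizes_term alpha beta delta :
  centralizes alpha beta delta -> term_condition alpha beta delta.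
Proof.
move=> cabd p q pq.
pose R := [set w : pair_alg beta * pair_alg beta |
  exists p q : pair_alg alpha, [/\ p ~[dcong alpha beta] q,
    pr1 p = pr1 w.1 /\ pr2 p = pr1 w.2 & pr1 q = pr2 w.1 /\ pr2 q = pr2 w.2]].
have DR : dcong beta alpha `<=` cong_gen R.
  apply: gen_sub => _ [[u v] /= uv <-]; apply: sub_gen.
  by exists (mkpair uv), (mkpair uv); split=> //; exact: cong_refl.
apply: (@gen_saturated _ _ R (fun p => pr1 p ~[delta] pr2 p)
  _ _ _ p q (DR _ pq)).
- move=> x y [u [v [uv [u1 u2] [v1 v2]]]]; exists (swap u), (swap v).
  by split=> //; exact: dcong_swap.
- move=> s i x y [u [v [uv [u1 u2] [v1 v2]]]] xy.
  exists (op s (fun j => if j == i then u else diag _ (pr1 (x j)))).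
  exists (op s (fun j => if j == i then v else diag _ (pr2 (x j)))).
  rewrite !homP; split.
  + apply: cong_op => j; case: eqP => // _.
    by apply: dcong_diag; exact: pairP.
  + split; congr (op s); apply/funext => j /=; case: eqP => [->//|/eqP ji] //=.
    by rewrite (xy j ji).
  + split; congr (op s); apply/funext => j /=; case: eqP => [->//|/eqP ji] //=.
    by rewrite (xy j ji).
- move=> x y [u [v [uv [u1 u2] [v1 v2]]]]; rewrite -u1 -u2 -v1 -v2.
  exact: centralizes_shift cabd uv.
Qed.

(** From a matrix with equal first entries, shifting along the kernels of the
    two projections, whose meet is trivial, produces the matrix with rows (z,
    z) and (z, w), to which the term condition applies. *)
Lemma term_centralizes alpha beta delta :
  term_condition alpha beta delta -> centralizes beta alpha delta.
Proof.
move=> tc p q pq k.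
have zw : pr2 p ~[beta] pr2 q.
  by apply: cong_trans (cong_sym (pairP p)) _; rewrite k; exact: pairP.
suff h : diag beta (pr2 p) ~[dcong beta alpha] mkpair zw.
  by apply: (tc _ _ h); exact: cong_refl.
apply: (@shifting _ _ (@pair_modular _) (Ker pr1) (Ker pr2) (dcong beta alpha)
  _ _ p q) => //.
by move=> [p1 q1] [k1 k2]; exact: (eq_cong _ (pair_ext k1 k2)).
Qed.

Lemma centralizesC alpha beta delta :
  centralizes alpha beta delta -> centralizes beta alpha delta.
Proof. by move/centralizes_term/term_centralizes. Qed.

Lemma centralizesE alpha beta delta :
  centralizes alpha beta delta <-> term_condition alpha beta delta.
Proof.
split; first exact: centralizes_term.
by move/term_centralizes; exact: centralizesC.
Qed.

(** In the form of the term condition, alpha only occurs through the congruence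
    [dcong beta alpha], which is monotone and join-preserving in alpha. *)
Lemma centralizes_sup S beta delta :
  (forall alpha, S alpha -> centralizes alpha beta delta) ->
  centralizes (cong_sup S) beta delta.
Proof.
move=> Sc; apply/centralizesE => p q pq.
have DS : dcong beta (cong_sup S) `<=` cong_sup [set dcong beta a | a in S].
  apply: dcong_sub => u v uv.
  have : cong_sup S `<=`
      cong_preimage (diag beta) (cong_sup [set dcong beta a | a in S]).
    apply: sup_sub => a Sa [x y] /= /(@dcong_diag _ _ beta) xy.
    by apply: sub_sup xy; exists a.
  by move=> /(_ _ uv).
apply: (sup_saturated (U := fun p => pr1 p ~[delta] pr2 p) _ (DS _ pq)).
by move=> _ x y [a Sa <-] xy; apply: (centralizes_term (Sc _ Sa) xy).
Qed.

Lemma centralizes_join alpha alpha' beta delta :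
  centralizes alpha beta delta -> centralizes alpha' beta delta ->
  centralizes (cong_join alpha alpha') beta delta.
Proof. by move=> c c'; rewrite joinE; apply: centralizes_sup => _ [->|->]. Qed.

(** Moving both entries of a row inside their delta-classes does not change
    whether the row is in delta. *)
Lemma centralizes_self beta delta : centralizes delta beta delta.
Proof.
apply/centralizesE => p q pq d; apply: cong_trans (dcong_pr2 pq).
by apply: cong_trans d; apply: cong_sym; exact: dcong_pr1.
Qed.

Lemma centralizes_monol alpha alpha' beta delta : alpha `<=` alpha' ->
  centralizes alpha' beta delta -> centralizes alpha beta delta.
Proof.
move=> aa /centralizesE tc; apply/centralizesE => p q pq; apply: tc.
by apply: (dcong_sub _ pq) => u v /aa; exact: dcong_diag.
Qed.

Definition modular_comm alpha beta : congruence A :=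
  cong_gen [set (pr2 w.1, pr2 w.2) | w in
    [set w : pair_alg alpha * pair_alg alpha |
      w.1 ~[dcong alpha beta] w.2 /\ pr1 w.1 = pr1 w.2]].

Lemma modular_commP alpha beta delta :
  modular_comm alpha beta `<=` delta <-> centralizes alpha beta delta.
Proof.
split=> [Dd p q pq k|cabd]; first by apply: Dd; apply: sub_gen; exists (p, q).
by apply: gen_sub => _ [[p q] /= [pq k] <-]; exact: cabd.
Qed.

Lemma modular_commI alpha beta :
  modular_comm alpha beta `<=` alpha `&` beta.
Proof.
have -> : alpha `&` beta = cong_meet alpha beta by [].
apply/modular_commP => p q pq k; split; last exact: dcong_pr2 pq.
by apply: cong_trans (cong_sym (pairP p)) _; rewrite k; exact: pairP.
Qed.

End OneAlgebra.

Section Surjection.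
Variables (A B : member V) (f : hom A B).
Hypothesis f_surj : surjective f.

Lemma image_reflect (delta : congruence A) x y : Ker f `<=` delta ->
  f x ~[cong_image f delta] f y -> x ~[delta] y.
Proof.
move=> Kd; rewrite cong_imageE // => -[[a b] /= ab [fa fb]].
apply: cong_trans (_ : a ~[_] y); first by apply: Kd => /=.
by apply: cong_trans ab _; apply: Kd => /=.
Qed.

(** The term condition is a saturation property, and saturated sets pass
    through the surjection F between pair algebras: the preimage under F of a
    set is saturated by the kernel of F, hence by its join with [dcong beta
    alpha], whose image is a congruence. *)
Lemma centralizes_image (alpha beta delta : congruence A) :
  Ker f `<=` alpha -> Ker f `<=` beta -> Ker f `<=` delta ->
  centralizes alpha beta delta ->
  centralizes (cong_image f alpha) (cong_image f beta) (cong_image f delta).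
Proof.
move=> Ka Kb Kd /centralizesE tc; apply/centralizesE => p q.
have bi : beta `<=` cong_preimage f (cong_image f beta).
  by move=> [x y]; exact: cong_image_in.
pose F := pair_map bi.
have Fsurj : surjective F.
  move=> r; have := pairP r; rewrite {1}cong_imageE //.
  move=> [[a b] /= ab [fa fb]].
  by exists (mkpair ab); exact: (@pair_ext _ _ _ (F (mkpair ab)) r fa fb).
pose G := cong_join (dcong beta alpha) (Ker F).
have DG : dcong (cong_image f beta) (cong_image f alpha) `<=` cong_image F G.
  apply: dcong_sub => u v; rewrite {1}cong_imageE // => -[[a b] /= ab [<- <-]].
  have FE c : F (diag beta c) = diag (cong_image f beta) (f c).
    exact: (@pair_ext _ _ _ (F (diag beta c))).
  have : F (diag beta a) ~[cong_image F G] F (diag beta b).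
    by apply: cong_image_in; apply: sub_joinl; exact: dcong_diag.
  by rewrite !FE.
move=> /DG; rewrite cong_imageE //; last exact: sub_joinr.
case=> -[p' q'] /= pq' [<- <-] /= /(image_reflect Kd) d.
apply: cong_image_in.
pose U := [set p : pair_alg beta | pr1 p ~[delta] pr2 p].
suff /(_ _ _ pq' d) : forall x y, x ~[G] y -> U x -> U y by [].
apply: join_saturated => x y; first exact: tc.
move=> kxy dx; have k1 := congr1 pr1 kxy; have k2 := congr1 pr2 kxy.
apply: cong_trans (_ : pr1 x ~[_] _); first by apply: Kd => /=.
by apply: cong_trans dx _; apply: Kd => /=.
Qed.

(** Put delta := [alpha, beta] v Ker f. Then alpha and Ker f both centralize
    beta modulo delta, and so, by symmetry and additivity, do alpha v Ker f and
    beta v Ker f, with Ker f below all three congruences; this descends to the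
    image of f. *)
Lemma modular_comm_image (alpha beta : congruence A) :
  cong_join (modular_comm alpha beta) (Ker f) =
  cong_preimage f (modular_comm (cong_image f (cong_join alpha (Ker f)))
                               (cong_image f (cong_join beta (Ker f)))).
Proof.
set aB := cong_image f _; set bB := cong_image f _.
apply: cong_anti.
- apply: join_sub; last first.
    by move=> [x y] xy; exact: (eq_cong (modular_comm aB bB) xy).
  apply/modular_commP => p q pq k.
  have ai : alpha `<=` cong_preimage f aB.
    by move=> [x y] xy; apply: cong_image_in; exact: sub_joinl.
  apply: sub_gen; exists (pair_map ai p, pair_map ai q) => //=.
  split; last exact: (congr1 f k).
  apply: (dcong_sub (Theta := cong_preimage (pair_map ai) (dcong aB bB)) _ pq).
  move=> u v uv.
  have FE c : pair_map ai (diag alpha c) = diag aB (f c) by exact: pair_ext.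
  have : diag aB (f u) ~[dcong aB bB] diag aB (f v).
    by apply: dcong_diag; apply: cong_image_in; exact: sub_joinl.
  by rewrite -!FE.
- set delta := cong_join _ _ => -[x y] /= xy.
  have Kd : Ker f `<=` delta by exact: sub_joinr.
  apply: (image_reflect Kd).
  have cab : centralizes alpha beta delta.
    by apply/modular_commP; exact: sub_joinl.
  have cK gamma : centralizes (Ker f) gamma delta.
    exact: centralizes_monol Kd (@centralizes_self _ _ _).
  suff : modular_comm aB bB `<=` cong_image f delta by exact.
  apply/modular_commP; apply: centralizes_image => //; try exact: sub_joinr.
  apply: centralizes_join => //.
  apply: centralizesC; apply: centralizes_join => //.
  exact: centralizesC.
Qed.

End Surjection.

Lemma modular_comm_operation : commutator_operation (@modular_comm).
Proof.
by split=> [A alpha beta|A B f fs alpha beta]; [exact: modular_commI|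
  exact: modular_comm_image].
Qed.

(** In the algebra alpha, C maps the kernel eta of the first projection and
    [dcong alpha beta] below their meet, which the second projection sends into
    [modular_comm alpha beta] by definition; and the images of eta and [dcong
    alpha beta] under the second projection are alpha and beta. *)
Lemma commutator_operation_sub (C : cong_operation V) (A : member V)
  (alpha beta : congruence A) :
  commutator_operation C -> C A alpha beta `<=` modular_comm alpha beta.
Proof.
move=> [C1 C2].
have := C2 (pair_member alpha) A pr2 (@pr2_surj _ _ alpha)
  (Ker pr1) (dcong alpha beta).
have -> : cong_image pr2 (cong_join (Ker (@pr1 _ _ alpha)) (Ker pr2)) = alpha.
  apply: cong_anti.
  - apply: cong_image_sub; apply: join_sub => -[p q] /= k; last exact: eq_cong.
    by apply: cong_trans (cong_sym (pairP p)) _; rewrite /= k; exact: (pairP q).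
  - move=> [z w] zw.
    have : diag alpha z ~[cong_join (Ker pr1) (Ker pr2)] mkpair zw.
      exact: sub_joinl.
    by move/(@cong_image_in _ _ _ pr2).
have -> : cong_image pr2 (cong_join (dcong alpha beta) (Ker pr2)) = beta.
  apply: cong_anti.
  - apply: cong_image_sub; apply: join_sub => -[p q] /=; last exact: eq_cong.
    exact: dcong_pr2.
  - move=> [z w] /(@dcong_diag _ _ alpha) zw.
    have : diag alpha z ~[cong_join (dcong alpha beta) (Ker pr2)] diag alpha w.
      exact: sub_joinl.
    by move/(@cong_image_in _ _ _ pr2).
move=> E [z w] zw.
have : diag alpha z ~[cong_preimage pr2 (C A alpha beta)] diag alpha w by [].
rewrite -E; suff h : cong_join
    (C (pair_member alpha) (Ker pr1) (dcong alpha beta)) (Ker pr2)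
    `<=` cong_preimage pr2 (modular_comm alpha beta) by move/h.
apply: join_sub => [[p q] /C1 [k pq]|[p q] k]; last first.
  exact: (eq_cong (modular_comm alpha beta) k).
by apply: sub_gen; exists (p, q).
Qed.

(** A greatest commutator operation exists, namely [modular_comm], so that
    [comm] is the greatest one and not its default value, the meet. *)
Lemma commE (A : member V) (alpha beta : congruence A) :
  comm alpha beta = modular_comm alpha beta.
Proof.
rewrite /comm; case: pselect => [ex|[]]; last first.
  exists (@modular_comm); split; first exact: modular_comm_operation.
  by move=> C Cop A' a b; exact: commutator_operation_sub.
have [Cop Cmax] := projT2 (cid ex).
apply: cong_anti; first exact: commutator_operation_sub.
exact: (Cmax _ modular_comm_operation).
Qed.

End Centrality.

(** * Semidegeneracy *)

Section Quotient.
Context {sg : signature} {A : algebra sg} (theta : congruence A).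

Definition cong_class (x : A) : set A := [set y | x ~[theta] y].

Definition quotient_carrier := {U : set A | exists x, U = cong_class x}.

Definition to_quotient (x : A) : quotient_carrier :=
  exist _ (cong_class x) (ex_intro _ x erefl).

Definition quotient_repr (U : quotient_carrier) : A :=
  projT1 (cid (proj2_sig U)).

Lemma to_quotientP x y : to_quotient x = to_quotient y <-> x ~[theta] y.
Proof.
split=> [/(congr1 sval) /= xy|xy].
  by have : cong_class y y by [exact: cong_refl]; rewrite -xy.
have e : cong_class x = cong_class y.
  apply/seteqP; split=> z; apply: cong_trans => //; exact: cong_sym.
by rewrite /to_quotient; apply: eq_exist.
Qed.

Lemma quotient_reprK U : to_quotient (quotient_repr U) = U.
Proof.
rewrite /quotient_repr; case: cid => x /= Ux.
by case: U Ux => U exU /= UE; apply: eq_exist.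
Qed.

Definition quotient : algebra sg :=
  @Algebra sg quotient_carrier
    (fun s U => to_quotient (op s (quotient_repr \o U)))
    (let: inhabits a := carrier_nonempty A in inhabits (to_quotient a)).

Definition quotient_hom : hom A quotient.
Proof.
refine (@Hom sg A quotient to_quotient _) => s x.
apply/to_quotientP/cong_op => i; apply/to_quotientP.
by rewrite /= quotient_reprK.
Defined.

Lemma quotient_hom_surj : surjective quotient_hom.
Proof. by move=> U; exists (quotient_repr U); exact: quotient_reprK. Qed.

End Quotient.

Section Semidegenerate.
Context {sg : signature} (V : variety sg) (V_semidegenerate : semidegenerate V).

(** The class of a is a one-element subalgebra of the quotient. *)
Lemma idempotent_class_Nabla (A : member V) (theta : congruence A) (a : A) :
  (forall s, op s (fun=> a) ~[theta] a) -> theta = Nabla.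
Proof.
move=> ta; apply: Nabla_eq => -[x y] _.
have QV := variety_H (@quotient_hom_surj _ _ theta) (memberP A).
apply/to_quotientP; apply: contrapT => xy.
apply: (V_semidegenerate (A := Member QV)).
  by exists (to_quotient theta x), (to_quotient theta y).
exists (quotient_hom theta a) => s u /= ua.
have -> : u = quotient_hom theta \o (fun=> a) by apply/funext.
have : quotient_hom theta (op s (fun=> a)) = quotient_hom theta a.
  exact/to_quotientP.
by rewrite homP.
Qed.

(** By [idempotent_class_Nabla] the finitely many pairs (op s (a, ..., a), a),
    one for each operation symbol, generate Nabla. Each of them lies in the
    join of a finite subfamily of S, since these joins form a directed family
    whose union is a congruence. *)
Lemma Nabla_compact (A : member V) : compact_cong (@Nabla _ A).
Proof.
move=> S NS; have [a] := carrier_nonempty A.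
pose T := [set p : A * A | exists F : set (congruence A),
  [/\ finite_set F, F `<=` S & cong_set (cong_sup F) p]].
have supS (F F' : set (congruence A)) :
    F `<=` F' -> cong_sup F `<=` cong_sup F'.
  by move=> FF; apply: sup_sub => alpha /FF; exact: sub_sup.
have T_fin (I : finType) (p : I -> A * A) : (forall i, T (p i)) ->
    exists F : set (congruence A),
      [/\ finite_set F, F `<=` S & forall i, cong_set (cong_sup F) (p i)].
  move=> Tp; pose F i := projT1 (cid (Tp i)).
  have FP i : [/\ finite_set (F i), F i `<=` S &
      cong_set (cong_sup (F i)) (p i)].
    by rewrite /F; case: cid.
  exists (\bigcup_i F i); split.
  - apply: bigcup_finite => [|i _]; first exact: finite_finset.
    by have [] := FP i.
  - by move=> alpha [i _]; have [_ FS _] := FP i; exact: FS.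
  - by move=> i; have [_ _] := FP i; apply: supS => alpha; exists i.
have [C CE] : exists C : congruence A, C = T :> set (A * A).
  unshelve eexists (@Congruence sg A T _ _ _ _) => //.
  - by move=> x; exists set0; split => //; exact: cong_refl.
  - by move=> x y [F [? ? xy]]; exists F; split => //; exact: cong_sym.
  - move=> x y z xy yz.
    have [|F [F1 F2 F3]] := @T_fin bool (fun b => if b then (x, y) else (y, z)).
      by case.
    exists F; split => //; exact: cong_trans (F3 true) (F3 false).
  - move=> s x y /T_fin[F [F1 F2 F3]]; exists F; split => //.
    exact: cong_op.
have SC : cong_sup S `<=` C.
  apply: sup_sub => alpha Sa p ap; rewrite CE; exists [set alpha]; split => //.
  - by move=> _ ->.
  - by apply: sub_sup ap.
have [|F [F1 F2 F3]] := @T_fin (symbol sg) (fun s => (op s (fun=> a), a)).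
  by move=> s; rewrite -CE; apply: SC; exact: NS.
by exists F; split => //; rewrite (idempotent_class_Nabla F3).
Qed.

(** All diagonal elements are related, and the diagonal is a subalgebra. *)
Lemma dcong_Nabla (A : member V) (alpha : congruence A) :
  dcong alpha Nabla = Nabla.
Proof.
have [a] := carrier_nonempty A.
apply: (@idempotent_class_Nabla (pair_member alpha) _ (diag alpha a)) => s.
have -> : op s (fun=> diag alpha a) = diag alpha (op s (fun=> a)).
  by rewrite homP.
exact: dcong_diag.
Qed.

End Semidegenerate.

(** * Compact totally disconnected spaces *)

Section QuasiComponents.
Variable T : topologicalType.

Definition quasi_component (x : T) : set T :=
  \bigcap_(C in [set C : set T | clopen C /\ C x]) C.

Lemma quasi_component_closed x : closed (quasi_component x).
Proof. by apply: closed_bigI => C [[]]. Qed.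

(** Otherwise the traces on K of the clopen sets containing x generate a proper
    filter, a cluster point of which would belong to all these clopen sets. *)
Lemma clopen_avoiding x (K : set T) : compact K ->
  K `&` quasi_component x = set0 ->
  exists C, [/\ clopen C, C x & C `&` K = set0].
Proof.
move=> Kc KQ; apply: contrapT => noC.
pose F := filter_from [set C : set T | clopen C /\ C x] (fun C => C `&` K).
have FF : ProperFilter F.
  apply: filter_from_proper; last first.
    move=> C [Cc Cx]; apply/set0P/eqP => CK0.
    by apply: noC; exists C.
  apply: filter_from_filter; first by exists setT; split => //; exact: clopenT.
  move=> C D [Cc Cx] [Dc Dx]; exists (C `&` D).
    by split => //; exact: clopenI.
  by move=> y [[]].
have [|w [Kw wF]] := Kc F FF.
  by exists setT => [|y []//]; split => //; exact: clopenT.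
have [C [Cc Cx] nCw] : exists2 C, clopen C /\ C x & ~ C w.
  apply: contrapT => nC; suff : (K `&` quasi_component x) w by rewrite KQ.
  by split => // C CP; apply: contrapT => nCw; apply: nC; exists C.
have FC : F (C `&` K) by exists C.
have nC : nbhs w (~` C).
  by apply: open_nbhs_nbhs; split => //; apply: closed_openC; case: Cc.
by have [w' [[Cw' _]]] := wF _ _ FC nC.
Qed.

Hypotheses (T_hausdorff : hausdorff_space T) (T_compact : compact [set: T]).

(** Separate F from G by an open U containing F whose closure misses G. The
    boundary of U misses the quasi-component, hence some clopen C containing x;
    then the trace of U on C is clopen and contains x, so that it contains G.
    *)
Lemma quasi_component_split x (F G : set T) : closed F -> closed G ->
  F `&` G = set0 -> quasi_component x = F `|` G -> F x -> G = set0.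
Proof.
move=> Fc Gc FG0 QE Fx.
have nF : set_nbhs F (~` G).
  apply/set_nbhsP; exists (~` G); split => //; first exact: closed_openC.
  exact/disjoints_subset.
have TN := compact_normal T_hausdorff T_compact.
have [W /set_nbhsP[U [Uo FU UW]] WG] := TN F Fc _ nF.
have UG y : closure U y -> ~ G y by move=> /(closureS UW)/WG.
pose K := closure U `\` U.
have Kc : compact K.
  apply: (subclosed_compact _ T_compact) => //.
  by apply: closedI; [exact: closed_closure|exact: open_closedC].
have [|C [[Co Cc] Cx CK]] := @clopen_avoiding x K Kc.
  rewrite QE -subset0 => y [[cUy nUy] [/FU//|Gy]]; exact: UG Gy.
have CU : C `&` U = C `&` closure U.
  apply/seteqP; split=> y [Cy Uy]; split => //; first exact: subset_closure.
  by apply: contrapT => nUy; suff : (C `&` K) y by rewrite CK.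
have clopenCU : clopen (C `&` U).
  split; first exact: openI.
  by rewrite CU; apply: closedI => //; exact: closed_closure.
rewrite -subset0 => y Gy; have : quasi_component x y by rewrite QE; right.
move=> /(_ (C `&` U))[|_ Uy]; first by split => //; split => //; exact: FU.
by apply: UG Gy; exact: subset_closure.
Qed.

Lemma quasi_component_connected x : connected (quasi_component x).
Proof.
move=> B [b Bb] [O Oo BO] [D Dc BD].
have Qc := @quasi_component_closed x.
have Qx : quasi_component x x by move=> C [].
have Bc : closed B by rewrite BD; exact: closedI.
have B'c : closed (quasi_component x `&` ~` O).
  by apply: closedI => //; exact: open_closedC.
have BB' : B `&` (quasi_component x `&` ~` O) = set0.
  by rewrite BO -subset0 => y [[_ Oy] [_]].
have QE : quasi_component x = B `|` (quasi_component x `&` ~` O).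
  rewrite BO; apply/seteqP; split=> [y Qy|y [[]|[]]//].
  by have [Oy|nOy] := pselect (O y); [left|right].
have [Ox|nOx] := pselect (O x).
- have B'0 := quasi_component_split Bc B'c BB' QE.
  by rewrite [RHS]QE B'0 ?setU0 // BO.
- rewrite setIC in BB'; rewrite setUC in QE.
  by move: Bb; rewrite (quasi_component_split B'c Bc BB' QE).
Qed.

Lemma totally_disconnected_zero_dimensional :
  totally_disconnected [set: T] -> zero_dimensional T.
Proof.
move=> Ttd x y xy; apply: contrapT => noU.
have : connected_component setT x y.
  exists (quasi_component x); first split => //.
  - by move=> C [].
  - exact: quasi_component_connected.
  - move=> C [Cc Cx]; apply: contrapT => nCy; apply: noU.
    by exists C.
by rewrite Ttd //= => yx; move: xy; rewrite yx eqxx.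
Qed.

End QuasiComponents.

(** The clopen sets that separate two points are found inside the disjoint open
    neighbourhoods provided by the Hausdorff property. *)
Lemma clopen_basis_zero_dimensional (T : topologicalType) :
  hausdorff_space T -> clopen_basis_space T -> zero_dimensional T.
Proof.
move=> hT [B Bc [_ bas]] x y; move: hT; rewrite open_hausdorff => /[apply].
move=> [[U W] /= [/set_mem Ux /set_mem Wy] [Uo Wo /eqP UW0]].
have [C [BC Cx] CU] := bas x U (open_nbhs_nbhs (conj Uo Ux)).
exists C; split => //; first exact: Bc.
by move=> /CU Uy; suff : (U `&` W) y by rewrite UW0.
Qed.

(** * Arithmetic of congruences *)

Section SemidegenerateModular.
Context {sg : signature} (V : variety sg).
Hypotheses (V_modular : congruence_modular V)
           (V_semidegenerate : semidegenerate V).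
Variable A : member V.
Implicit Types (alpha beta gamma delta phi psi theta nu e f : congruence A)
               (S F : set (congruence A)).

Lemma comm_sub_iff alpha beta delta :
  comm alpha beta `<=` delta <-> centralizes alpha beta delta.
Proof. by rewrite commE //; exact: modular_commP. Qed.

Lemma commC alpha beta : comm alpha beta = comm beta alpha.
Proof.
by apply: cong_anti; apply/comm_sub_iff/centralizesC => //; exact/comm_sub_iff.
Qed.

Lemma comm_supl S beta delta :
  (forall alpha, S alpha -> comm alpha beta `<=` delta) ->
  comm (cong_sup S) beta `<=` delta.
Proof.
move=> Sd; apply/comm_sub_iff; apply: centralizes_sup => // alpha Sa.
by apply/comm_sub_iff; exact: Sd.
Qed.

Lemma comm_joinl alpha alpha' beta delta :
  comm alpha beta `<=` delta -> comm alpha' beta `<=` delta ->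
  comm (cong_join alpha alpha') beta `<=` delta.
Proof. by move=> d d'; rewrite joinE; apply: comm_supl => _ [->|->]. Qed.

Lemma comm_mono alpha alpha' beta beta' : alpha `<=` alpha' ->
  beta `<=` beta' -> comm alpha beta `<=` comm alpha' beta'.
Proof.
have monol (a a' b : congruence A) : a `<=` a' -> comm a b `<=` comm a' b.
  move=> aa; apply/comm_sub_iff; apply: centralizes_monol aa _ => //.
  exact/comm_sub_iff.
move=> aa bb; apply: subset_trans (monol _ _ _ aa) _.
by rewrite commC [X in _ `<=` cong_set X]commC; exact: monol.
Qed.

Lemma comm_subl alpha beta : comm alpha beta `<=` alpha.
Proof. by move=> p /comm_sub[]. Qed.

Lemma comm_subr alpha beta : comm alpha beta `<=` beta.
Proof. by move=> p /comm_sub[]. Qed.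

(** A pair (x, y) in alpha is an element of the pair algebra that has the same
    first projection as (x, x) and is related to it by [dcong alpha Nabla]. *)
Lemma comm_Nabla alpha : comm alpha Nabla = alpha.
Proof.
apply: cong_anti; first exact: comm_subl.
move=> [x y] xy.
have /comm_sub_iff/(_ (diag alpha x) (mkpair xy)) :
  comm alpha Nabla `<=` comm alpha Nabla by [].
by rewrite dcong_Nabla //; apply.
Qed.

(** Since [gamma, Nabla] = gamma, a congruence can be recovered from its
    commutators with two comaximal congruences, as an ideal from its
    localizations. *)
Lemma comaximal_sub alpha beta gamma delta : cong_join alpha beta = Nabla ->
  comm gamma alpha `<=` delta -> comm gamma beta `<=` delta -> gamma `<=` delta.
Proof.
by move=> ab ga gb; rewrite -(comm_Nabla gamma) -ab commC; apply: comm_joinl;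
  rewrite commC.
Qed.

Lemma comaximal_comm theta alpha beta : cong_join theta alpha = Nabla ->
  cong_join theta beta = Nabla -> cong_join theta (comm alpha beta) = Nabla.
Proof.
move=> ta tb; apply: Nabla_eq; set delta := cong_join _ _.
have td gamma : comm gamma theta `<=` delta.
  apply: (subset_trans (B := theta)); [exact: comm_subr|exact: sub_joinl].
apply: (comaximal_sub ta (td _)); rewrite commC comm_Nabla.
by apply: (comaximal_sub tb (td _)); exact: sub_joinr.
Qed.

Lemma chain_bound S F : S !=set0 ->
  (forall alpha beta, S alpha -> S beta ->
    alpha `<=` beta \/ beta `<=` alpha) ->
  finite_set F -> F `<=` S ->
  exists2 beta, S beta & forall alpha, F alpha -> alpha `<=` beta.
Proof.
move=> S0 Stot /finite_seqP[s ->] {F}; elim: s => [|a s IH] sS.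
  by have [b Sb] := S0; exists b.
have [|b Sb sb] := IH; first by move=> c cs; apply: sS; rewrite /= inE cs orbT.
have Sa : S a by apply: sS; rewrite /= inE eqxx.
have [ab|ba] := Stot _ _ Sa Sb; [exists b => //|exists a => //] => c /=;
  rewrite inE => /orP[/eqP ->//|cs]; first exact: sb.
by apply: subset_trans ba; exact: sb.
Qed.

(** The bound of a chain C of proper congruences above theta is the join of
    theta and C; theta is included to deal with the empty chain. *)
Lemma sub_maximal theta : theta <> Nabla ->
  exists2 phi, maximal_cong phi & theta `<=` phi.
Proof.
move=> tN; pose T := {phi : congruence A | theta `<=` phi /\ phi <> Nabla}.
pose R (x y : T) := `[< sval x `<=` sval y >].
have t0 : T by exists theta; split.
have [| | |[phi [tp pN]] pmax] := @ZL_preorder T t0 R.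
- by move=> x; apply/asboolP.
- move=> x y z /asboolP xy /asboolP yz; apply/asboolP.
  exact: subset_trans yz.
- move=> C Ctot; pose S := [set theta] `|` [set sval x | x in C].
  have SN alpha : S alpha -> theta `<=` alpha /\ alpha <> Nabla.
    by case=> [->|[[a [ta aN]] _ <-]]; split.
  have supN : cong_sup S <> Nabla.
    move=> SE; have [|F [F1 F2 F3]] := Nabla_compact V_semidegenerate (S := S).
      by rewrite SE.
    have [||b Sb Fb] := chain_bound _ _ F1 F2.
    + by exists theta; left.
    + move=> a b Sa Sb; case: (Sa) => [->|[x Cx xa]].
        by left; have [] := SN b Sb.
      case: (Sb) => [->|[y Cy yb]]; first by right; have [] := SN a Sa.
      by have [/asboolP|/asboolP] := Ctot _ _ Cx Cy; rewrite xa yb;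
        [left|right].
    + have [_ []] := SN b Sb; apply: Nabla_eq; apply: subset_trans F3 _.
      exact: sup_sub.
  have supT : theta `<=` cong_sup S by apply: sub_sup; left.
  exists (exist _ (cong_sup S) (conj supT supN)) => x Cx; apply/asboolP.
  by apply: sub_sup; right; exists x.
- exists phi => //; split => // psi psiN pp; apply: cong_anti => //.
  have tpsi : theta `<=` psi by apply: subset_trans pp.
  by have /asboolP := pmax (exist _ psi (conj tpsi psiN)) (asboolT pp).
Qed.

Lemma Nabla_of_maximal theta :
  (forall phi, maximal_cong phi -> ~ theta `<=` phi) -> theta = Nabla.
Proof.
by move=> tm; apply: contrapT => /sub_maximal[phi /tm].
Qed.

Lemma maximal_join phi alpha : maximal_cong phi -> ~ alpha `<=` phi ->
  cong_join phi alpha = Nabla.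
Proof.
move=> [_ pmax] ap; apply: contrapT => /pmax jp; apply: ap.
by rewrite -jp; [exact: sub_joinr|exact: sub_joinl].
Qed.

Lemma join_not_sub phi alpha : phi <> Nabla -> cong_join phi alpha = Nabla ->
  ~ alpha `<=` phi.
Proof.
by move=> pN pa ap; apply/pN/Nabla_eq; rewrite -pa; exact: join_sub.
Qed.

Lemma maximal_sub_eq phi psi : maximal_cong phi -> maximal_cong psi ->
  phi `<=` psi -> phi = psi.
Proof. by move=> [_ pmax] [psiN _] pp; rewrite (pmax psi). Qed.

Lemma maximal_comaximal phi psi : maximal_cong phi -> maximal_cong psi ->
  phi <> psi -> cong_join phi psi = Nabla.
Proof.
move=> pm sm neq; apply: maximal_join => // sp.
by apply/neq/esym/maximal_sub_eq.
Qed.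

(** If alpha and beta are both comaximal with phi, so is their commutator. *)
Lemma maximal_prime phi : maximal_cong phi -> prime_cong phi.
Proof.
move=> pm; split=> [|alpha beta ab]; first by case: pm.
apply: contrapT => /not_orP[/(maximal_join pm) pa /(maximal_join pm) pb].
case: pm => + _; apply; rewrite -(comaximal_comm pa pb).
apply: cong_anti; [exact: sub_joinl|exact: join_sub].
Qed.

(** For comaximal congruences a trivial commutator is the same as a trivial
    meet; the commutator is the operation that distributes over joins. *)
Definition complements e f := cong_join e f = Nabla /\ comm e f = Delta.

Lemma complementsC e f : complements e f -> complements f e.
Proof. by move=> [ef1 ef0]; split; [rewrite joinC|rewrite commC]. Qed.

Lemma complements_perp e f : complements e f -> perp e = f.
Proof.
move=> [ef1 ef0]; apply: cong_anti; last exact: sub_sup.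
apply: sup_sub => gamma eg; apply: (comaximal_sub ef1); last exact: comm_subr.
by rewrite commC eg; exact: Delta_sub.
Qed.

Lemma complements_boolean e f : complements e f -> boolean_cong e.
Proof.
move=> [ef1 ef0]; exists f; split => //; apply: Delta_eq.
apply: (comaximal_sub ef1); rewrite -ef0; last first.
  by apply: comm_mono => // p [].
by rewrite [comm e f]commC; apply: comm_mono => // p [].
Qed.

Lemma boolean_perp e : boolean_cong e -> complements e (perp e).
Proof.
move=> [f [ef1 ef0]].
suff ef : complements e f by rewrite (complements_perp ef).
split=> //; apply: Delta_eq; rewrite -ef0.
exact: (@comm_sub _ _ A e f).
Qed.

Lemma perp_boolean e : boolean_cong e -> boolean_cong (perp e).
Proof. by move=> /boolean_perp/complementsC/complements_boolean. Qed.

Lemma perpK e : boolean_cong e -> perp (perp e) = e.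
Proof. by move=> /boolean_perp/complementsC/complements_perp. Qed.

Lemma boolean_Delta : boolean_cong (@Delta _ A).
Proof.
apply: (@complements_boolean _ Nabla); split; last by rewrite comm_Nabla.
by apply: Nabla_eq; exact: sub_joinr.
Qed.

Lemma boolean_join e f :
  boolean_cong e -> boolean_cong f -> boolean_cong (cong_join e f).
Proof.
move=> /boolean_perp[e1 e0] /boolean_perp[f1 f0].
apply: (@complements_boolean _ (comm (perp e) (perp f))); split.
  apply: comaximal_comm; apply: Nabla_eq; [rewrite -e1|rewrite -f1].
  - by apply: join_mono => //; exact: sub_joinl.
  - by apply: join_mono => //; exact: sub_joinr.
apply: Delta_eq; apply: comm_joinl; [rewrite -e0|rewrite -f0];
  apply: comm_mono => //.
- exact: comm_subl.
- exact: comm_subr.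
Qed.

Lemma boolean_sup F : finite_set F -> F `<=` @boolean_cong _ A ->
  boolean_cong (cong_sup F).
Proof.
move=> /finite_seqP[s ->] {F}; elim: s => [|a s IH].
  move=> _; suff -> : cong_sup [set` [::]] = Delta :> congruence A.
    exact: boolean_Delta.
  by apply: Delta_eq; apply: sup_sub.
have -> : [set` a :: s] = a |` [set` s].
  by apply/seteqP; split=> b /=; rewrite inE => /predU1P.
move=> sB.
suff -> : cong_sup (a |` [set` s]) = cong_join a (cong_sup [set` s]).
  apply: boolean_join; first by apply: sB; left.
  by apply: IH => b bs; apply: sB; right.
apply: cong_anti.
- apply: sup_sub => b [->|bs]; first exact: sub_joinl.
  by apply: subset_trans (@sub_joinr _ _ _ _); exact: sub_sup.
- apply: join_sub; first by apply: sub_sup; left.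
  by apply: sup_sub => b bs; apply: sub_sup; right.
Qed.

Lemma prime_boolean phi e : prime_cong phi -> boolean_cong e ->
  ~ e `<=` phi <-> perp e `<=` phi.
Proof.
move=> [pN pp] /boolean_perp[e1 e0]; split=> [ne|pe ep].
  by have [|//|//] := pp e (perp e); rewrite e0; exact: Delta_sub.
by apply: pN; apply: Nabla_eq; rewrite -e1; exact: join_sub.
Qed.

(** Each generator alpha of O(phi) comes with a beta that is not below phi and
    satisfies [alpha, beta] = Delta, so that primeness puts alpha below phi. *)
Lemma O_sub phi : prime_cong phi -> O_cong phi `<=` phi.
Proof.
move=> [_ pp]; apply: sup_sub => alpha [beta nb ab].
by have [|//|//] := pp alpha beta; rewrite ab; exact: Delta_sub.
Qed.

(** The complement of e is the witness: it is not below phi, because e is. *)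
Lemma boolean_sub_O phi e : prime_cong phi -> boolean_cong e ->
  e `<=` phi -> e `<=` O_cong phi.
Proof.
move=> pp eb ep; apply: sub_sup; exists (perp e).
  by rewrite -prime_boolean //; exact.
by have [] := boolean_perp eb.
Qed.

Definition boolean_separated := forall phi psi,
  maximal_cong phi -> maximal_cong psi -> phi <> psi ->
  exists alpha, [/\ boolean_cong alpha, alpha `<=` phi & perp alpha `<=` psi].

Lemma separated_O : boolean_separated -> forall phi psi,
  maximal_cong phi -> maximal_cong psi -> phi <> psi ->
  exists alpha, [/\ boolean_cong alpha, alpha `<=` O_cong phi
    & perp alpha `<=` O_cong psi].
Proof.
move=> sepA phi psi pm sm neq.
have [alpha [ab ap as_]] := sepA phi psi pm sm neq; exists alpha; split => //.
- by apply: boolean_sub_O => //; exact: maximal_prime.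
- by apply: boolean_sub_O => //; [exact: maximal_prime|exact: perp_boolean].
Qed.

Lemma O_separated : (forall phi psi,
    maximal_cong phi -> maximal_cong psi -> phi <> psi ->
    exists alpha, [/\ boolean_cong alpha, alpha `<=` O_cong phi
      & perp alpha `<=` O_cong psi]) ->
  boolean_separated.
Proof.
move=> sepO phi psi pm sm neq.
have [alpha [ab ap as_]] := sepO phi psi pm sm neq; exists alpha; split => //.
- exact: subset_trans (O_sub (maximal_prime pm)).
- exact: subset_trans (O_sub (maximal_prime sm)).
Qed.

Lemma normal_separated : congruence_normal A ->
  forall phi psi, maximal_cong phi -> maximal_cong psi -> phi <> psi ->
  exists alpha beta, [/\ ~ alpha `<=` phi, ~ beta `<=` psi &
    comm alpha beta = Delta].
Proof.
move=> nA phi psi pm sm neq.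
have [alpha [beta [pa sb ab]]] := nA _ _ (maximal_comaximal pm sm neq).
by exists alpha, beta; split => //; [apply: join_not_sub pa; case: pm|
  apply: join_not_sub sb; case: sm].
Qed.

Lemma B_normal_normal : congruence_B_normal A -> congruence_normal A.
Proof.
by move=> nA theta nu /nA[alpha [beta [_ _ ta nb ab]]]; exists alpha, beta.
Qed.

Lemma B_normal_separated : congruence_B_normal A -> boolean_separated.
Proof.
move=> nA phi psi pm sm neq.
have [alpha [beta [ab _ pa sb a_b]]] := nA _ _ (maximal_comaximal pm sm neq).
have nap : ~ alpha `<=` phi by apply: join_not_sub pa; case: pm.
have nbp : ~ beta `<=` psi by apply: join_not_sub sb; case: sm.
exists (perp alpha); split; first exact: perp_boolean.
  exact/prime_boolean/nap/ab/maximal_prime.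
rewrite perpK //; have [_ /(_ alpha beta)[|//|//]] := maximal_prime sm.
by rewrite a_b; exact: Delta_sub.
Qed.

(** The join of theta and of all complemented congruences below phi is Nabla,
    since separation excludes every maximal congruence other than phi from
    lying above it. By compactness finitely many of them, with complemented
    join e, suffice; then the complement of e lies below theta and is not below
    phi. *)
Lemma separated_below phi theta : boolean_separated -> maximal_cong phi ->
  ~ theta `<=` phi ->
  exists e, [/\ boolean_cong e, e `<=` theta & ~ e `<=` phi].
Proof.
move=> sepA pm tp; pose S := [set e | boolean_cong e /\ e `<=` phi].
have [|F [F1 F2 F3]] := Nabla_compact V_semidegenerate (S := [set theta] `|` S).
  suff -> : cong_sup ([set theta] `|` S) = Nabla by [].
  apply: Nabla_of_maximal => psi sm Ssub.
  have tpsi : theta `<=` psi by apply: subset_trans Ssub; apply: sub_sup; left.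
  have [|alpha [ab ap as_]] := sepA phi psi pm sm.
    by move=> pe; subst psi.
  move: as_; rewrite -prime_boolean //; last exact: maximal_prime.
  by apply; apply: subset_trans Ssub; apply: sub_sup; right.
pose e := cong_sup (F `&` S).
have eb : boolean_cong e.
  by apply: boolean_sup => [|f [_ []]//]; exact: finite_setIl.
have ep : e `<=` phi by apply: sup_sub => f [_ []].
have te : cong_join theta e = Nabla.
  apply: Nabla_eq; apply: subset_trans F3 _; apply: sup_sub => f Ff.
  case: (F2 _ Ff) => [->|Sf]; first exact: sub_joinl.
  by apply: subset_trans (@sub_joinr _ _ _ _); exact: sub_sup.
have [_ e0] := boolean_perp eb.
exists (perp e); split; first exact: perp_boolean.
- apply: (comaximal_sub te); first exact: comm_subr.
  by rewrite commC e0; exact: Delta_sub.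
- rewrite prime_boolean ?perpK //; [exact: maximal_prime|exact: perp_boolean].
Qed.

(** By [separated_below] the complemented congruences below theta or below nu
    have join Nabla. Compactness yields complemented e below theta and f below
    nu with e v f = Nabla; the complements of e and f are then the required
    congruences. *)
Lemma separated_B_normal : boolean_separated -> congruence_B_normal A.
Proof.
move=> sepA theta nu tn.
pose S := [set e | boolean_cong e /\ (e `<=` theta \/ e `<=` nu)].
have [|F [F1 F2 F3]] := Nabla_compact V_semidegenerate (S := S).
  suff -> : cong_sup S = Nabla by [].
  apply: Nabla_of_maximal => phi pm Sp.
  have below gamma : (forall e, e `<=` gamma -> e `<=` theta \/ e `<=` nu) ->
      gamma `<=` phi.
    move=> gS; apply: contrapT => /(separated_below sepA pm)[e [eb eg]]; apply.
    by apply: subset_trans Sp; apply: sub_sup; split => //; exact: gS.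
  have [+ _] := pm; apply; apply: Nabla_eq; rewrite -tn.
  by apply: join_sub; apply: below => e; [left|right].
pose part gamma := cong_sup (F `&` [set e | e `<=` gamma]).
have partB gamma : boolean_cong (part gamma).
  by apply: boolean_sup => [|f [/F2[]]//]; exact: finite_setIl.
have partS gamma : part gamma `<=` gamma by apply: sup_sub => f [].
have parts : cong_join (part theta) (part nu) = Nabla.
  apply: Nabla_eq; apply: subset_trans F3 _; apply: sup_sub => f Ff.
  case: (F2 _ Ff) => _ [ft|fn].
  - by apply: subset_trans (@sub_joinl _ _ _ _); exact: sub_sup.
  - by apply: subset_trans (@sub_joinr _ _ _ _); exact: sub_sup.
have join_perp gamma : cong_join gamma (perp (part gamma)) = Nabla.
  have [e1 _] := boolean_perp (partB gamma).
  by apply: Nabla_eq; rewrite -e1; exact: join_mono.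
exists (perp (part theta)), (perp (part nu)).
split => //; try exact: perp_boolean.
have [_ t0] := boolean_perp (partB theta).
have [_ n0] := boolean_perp (partB nu).
apply: Delta_eq; apply: (comaximal_sub parts); [rewrite -t0|rewrite -n0];
  rewrite [X in _ `<=` cong_set X]commC; apply: comm_mono => //.
- exact: comm_subl.
- exact: comm_subr.
Qed.

(** A regular congruence strictly above s(phi) would be above some complemented
    e that is not below phi; the complement of e is below phi, hence below
    s(phi). *)
Lemma s_cong_max_regular phi : prime_cong phi -> max_regular_cong (s_cong phi).
Proof.
move=> pp; have sp : s_cong phi `<=` phi by apply: sup_sub => e [].
split.
- by exists [set e | boolean_cong e /\ e `<=` phi] => // e [].
- move=> sN; have [+ _] := pp; apply; apply: Nabla_eq; rewrite -sN.
  exact: sp.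
- move=> theta [S SB ->] tN st; apply: cong_anti => //; apply: sup_sub => e Se.
  have eb := SB _ Se; apply: sub_sup; split => //; apply: contrapT => nep.
  apply: tN; apply: Nabla_eq; have [<- _] := boolean_perp eb.
  apply: join_sub; first exact: sub_sup.
  apply: subset_trans st; apply: sub_sup; split; first exact: perp_boolean.
  exact/prime_boolean.
Qed.

Lemma boolean_sub_s e phi : boolean_cong e ->
  e `<=` s_cong phi <-> e `<=` phi.
Proof.
move=> eb; split=> [es|ep]; last exact: sub_sup.
by apply: subset_trans es _; apply: sup_sub => f [].
Qed.

(** * The space of maximal congruences *)

Implicit Types (x y z : Max_Z A).

Lemma Max_cong_maximal x : maximal_cong (Max_cong x).
Proof. exact: set_mem (valP x). Qed.

Lemma Max_cong_prime x : prime_cong (Max_cong x).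
Proof. exact: set_mem (valP (\val x)). Qed.

Lemma Max_cong_inj : injective (@Max_cong _ _ A).
Proof. by move=> x y /val_inj/val_inj. Qed.

Lemma Max_cong_surj (phi : congruence A) :
  maximal_cong phi -> exists x, Max_cong x = phi.
Proof.
move=> pm; pose p : Spec A := SigSub (mem_set (maximal_prime pm)).
have pM : p \in [set phi : Spec A | maximal_cong (\val phi)] by apply: mem_set.
by exists (SigSub pM).
Qed.

Lemma Max_D_open theta : open (@Max_D _ _ A theta).
Proof. by exists (Spec_D theta) => //; exists theta. Qed.

Lemma open_Max_D (U : set (Max_Z A)) : open U -> exists theta, U = Max_D theta.
Proof. by move=> [_ [theta _ <-] <-]; exists theta. Qed.

Lemma Max_D_perp e : boolean_cong e -> @Max_D _ _ A (perp e) = ~` Max_D e.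
Proof.
move=> eb; apply/seteqP; split=> x /=.
- move=> nx ex; apply: nx; apply/(prime_boolean (Max_cong_prime x)) => //.
- by move=> ne /(prime_boolean (Max_cong_prime x) eb).
Qed.

Lemma Max_D_clopen e : boolean_cong e -> clopen (@Max_D _ _ A e).
Proof.
move=> eb; split; first exact: Max_D_open.
by rewrite -(perpK eb) Max_D_perp; [apply: open_closedC; exact: Max_D_open|
  exact: perp_boolean].
Qed.

(** If a proper filter F has no cluster point, each maximal congruence omits
    some theta such that the complement of Max_D theta is in F. These theta
    have join Nabla, so finitely many of them do; but the finitely many
    corresponding members of F have a common point, a maximal congruence above
    all of them. *)
Lemma Max_Z_compact : compact [set: Max_Z A].
Proof.
move=> F FF _; apply: contrapT => noc.
pose S := [set theta : congruence A | F (~` Max_D theta)].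
have [|G [/finite_seqP[s ->] sS sN]] :=
    @Nabla_compact _ _ V_semidegenerate A S.
  suff -> : cong_sup S = Nabla by [].
  apply: Nabla_of_maximal => phi pm Sphi.
  have [x xphi] := Max_cong_surj pm; apply: noc; exists x; split => //.
  move=> P Q FP; rewrite nbhsE => -[U [Uo Ux] UQ].
  have [theta UE] := open_Max_D Uo; apply: contrapT => PQ0.
  rewrite UE in Ux UQ; apply: Ux; rewrite /= -/(Max_cong x) xphi.
  apply: subset_trans Sphi; apply: sub_sup; apply: filterS FP => y Py yU.
  by apply: PQ0; exists y; split => //; exact: UQ.
have FS : F [set x | cong_sup [set` s] `<=` Max_cong x].
  elim: s sS {sN} => [_|a s IH sS].
    by apply: filterS filterT => x _; apply: sup_sub.
  have Fa : F (~` Max_D a) by apply: sS; rewrite /= inE eqxx.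
  have Fs : F [set x | cong_sup [set` s] `<=` Max_cong x].
    by apply: IH => b bs; apply: sS; rewrite /= inE bs orbT.
  apply: filterS (filterI Fa Fs) => x [/contrapT xa xs]; apply: sup_sub => b.
  rewrite /= inE => /predU1P[->//|bs].
  by apply: subset_trans xs; exact: sub_sup.
have [x xN] := filter_ex FS; have [+ _] := Max_cong_maximal x; apply.
by apply: Nabla_eq; exact: subset_trans xN.
Qed.

(** Primeness turns [alpha, beta] = Delta into disjointness of the open sets of
    alpha and beta. *)
Lemma normal_hausdorff : congruence_normal A -> hausdorff_space (Max_Z A).
Proof.
move=> nA; rewrite open_hausdorff => x y /eqP xy.
have [|alpha [beta [ax bY ab]]] := normal_separated nA
    (Max_cong_maximal x) (Max_cong_maximal y).
  by move/Max_cong_inj.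
exists (Max_D alpha, Max_D beta) => /=; first by rewrite !inE.
split; [exact: Max_D_open|exact: Max_D_open|].
apply/eqP; rewrite -subset0 => z [/= az bz].
have [_ /(_ alpha beta)[|//|//]] := Max_cong_prime z.
by rewrite ab; exact: Delta_sub.
Qed.

Lemma clopen_split (U : set (Max_Z A)) : clopen U ->
  exists theta nu, [/\ U = Max_D theta, ~` U = Max_D nu &
    cong_join theta nu = Nabla].
Proof.
move=> [Uo Uc]; have [theta UE] := open_Max_D Uo.
have [nu UCE] := open_Max_D (closed_openC Uc); exists theta, nu; split => //.
apply: Nabla_of_maximal => phi pm tn.
have [x xphi] := Max_cong_surj pm; subst phi.
have [Ux|nUx] := pselect (U x).
- by move: Ux; rewrite UE; apply; exact: subset_trans (@sub_joinl _ _ _ _) tn.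
- have : (~` U) x by [].
  by rewrite UCE; apply; exact: subset_trans (@sub_joinr _ _ _ _) tn.
Qed.

(** The maximal congruences outside U are above theta, hence miss alpha; those
    in U are above nu, hence miss beta. Therefore alpha v beta = Nabla, and
    alpha and beta complement each other. *)
Lemma normal_clopen (U : set (Max_Z A)) : congruence_normal A -> clopen U ->
  exists2 e, boolean_cong e & U = Max_D e.
Proof.
move=> nA /clopen_split[theta [nu [UE UCE tn]]].
have [alpha [beta [ta nb ab]]] := nA _ _ tn.
have aUC x : ~ U x -> ~ alpha `<=` Max_cong x.
  move=> nUx; have [xN _] := Max_cong_maximal x.
  have tx : theta `<=` Max_cong x.
    by apply: contrapT => tx; apply: nUx; rewrite UE.
  apply: (join_not_sub xN); apply: Nabla_eq; rewrite -ta; exact: join_mono.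
have bU x : U x -> ~ beta `<=` Max_cong x.
  move=> Ux; have [xN _] := Max_cong_maximal x.
  have nx : nu `<=` Max_cong x.
    apply: contrapT => nx; have : Max_D nu x by [].
    by rewrite -UCE.
  apply: (join_not_sub xN); apply: Nabla_eq; rewrite -nb; exact: join_mono.
have ba1 : complements beta alpha.
  split; last by rewrite commC.
  apply: Nabla_of_maximal => phi pm abp.
  have [x xphi] := Max_cong_surj pm; subst phi.
  have [Ux|nUx] := pselect (U x).
  - by apply: (bU _ Ux); exact: subset_trans (@sub_joinl _ _ _ _) abp.
  - by apply: (aUC _ nUx); exact: subset_trans (@sub_joinr _ _ _ _) abp.
have bb := complements_boolean ba1.
exists beta => //; apply/seteqP; split=> x; first exact: bU.
move=> bx; apply: contrapT => /aUC; apply.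
rewrite -(complements_perp ba1).
exact/(prime_boolean (Max_cong_prime x)).
Qed.

Lemma basis_clopen : basis [set Max_D alpha | alpha in @boolean_cong sg A] ->
  clopen_basis_space (Max_Z A).
Proof. by eexists; last exact: H; move=> _ [e eb <-]; exact: Max_D_clopen. Qed.

Lemma separated_basis : boolean_separated ->
  basis [set Max_D alpha | alpha in @boolean_cong sg A].
Proof.
move=> sepA; split=> [_ [e _ <-]|x U]; first exact: Max_D_open.
rewrite nbhsE => -[W [Wo Wx] WU]; have [theta WE] := open_Max_D Wo.
rewrite WE in Wx WU.
have [e [eb et ex]] := separated_below sepA
  (Max_cong_maximal x) Wx.
exists (Max_D e); first by split => //; exists e.
apply: subset_trans WU => y /= ey ty; apply: ey.
exact: subset_trans ty.
Qed.

Lemma basis_separated :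
  basis [set Max_D alpha | alpha in @boolean_cong sg A] -> boolean_separated.
Proof.
move=> [_ bas] phi psi pm sm neq.
have [x xphi] := Max_cong_surj pm; have [y ypsi] := Max_cong_surj sm.
have xy : nbhs x (Max_D psi).
  apply: open_nbhs_nbhs; split; first exact: Max_D_open.
  move=> sp; apply: neq; apply/esym/maximal_sub_eq => //.
  by rewrite -xphi.
have [_ [[e eb <-] ex] eD] := bas x _ xy.
exists (perp e); split; first exact: perp_boolean.
- by rewrite -xphi; apply/(prime_boolean (Max_cong_prime x)).
- rewrite perpK // -ypsi; apply: contrapT => /(eD y); apply.
  by rewrite -ypsi.
Qed.

Lemma zero_dimensional_separated : congruence_normal A ->
  zero_dimensional (Max_Z A) -> boolean_separated.
Proof.
move=> nA zd phi psi pm sm neq.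
have [x xphi] := Max_cong_surj pm; have [y ypsi] := Max_cong_surj sm.
have [|U [Uc Ux nUy]] := zd x y.
  by apply/eqP => xy; apply: neq; rewrite -xphi -ypsi xy.
have [e eb UE] := normal_clopen nA Uc; rewrite UE in Ux nUy.
exists (perp e); split; first exact: perp_boolean.
- by rewrite -xphi; apply/(prime_boolean (Max_cong_prime x)).
- by rewrite perpK // -ypsi; exact: contrapT.
Qed.

(** The values of s are maximal among proper regular congruences, so that two
    distinct ones are incomparable: some complemented congruence is below phi
    and not below psi, and then its complement is below psi. *)
Lemma s_injective_separated (s : Max_Z A -> Sp A) :
  (forall x, Sp_cong (s x) = s_cong (Max_cong x)) -> injective s ->
  boolean_separated.
Proof.
move=> sE sinj phi psi pm sm neq.
have [x xphi] := Max_cong_surj pm; have [y ypsi] := Max_cong_surj sm.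
apply: contrapT => noe.
have sxy : s_cong (Max_cong x) `<=` s_cong (Max_cong y).
  apply: sup_sub => e [eb ex]; apply: sub_sup; split => //.
  apply: contrapT => ey; apply: noe; exists e; split => //.
    by rewrite -xphi.
  by rewrite -ypsi; apply/(prime_boolean (Max_cong_prime y)).
apply: neq; rewrite -xphi -ypsi; congr Max_cong; apply: sinj; apply: val_inj.
rewrite -/(Sp_cong (s x)) -/(Sp_cong (s y)) !sE.
have [_ _ xmax] := s_cong_max_regular (Max_cong_prime x).
have [yr yN _] := s_cong_max_regular (Max_cong_prime y).
by rewrite (xmax _ yr yN).
Qed.

Lemma Sp_U_open e : boolean_cong e -> open (@Sp_U _ A e).
Proof.
move=> eb; exists [set Sp_U e]; last by rewrite bigcup_set1.
by move=> _ ->; exact: finI_from1.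
Qed.

Lemma Sp_open (U : set (Sp A)) : open U ->
  exists2 D, D `<=` finI_from (@boolean_cong _ A) (@Sp_U _ A) &
    \bigcup_(B in D) B = U.
Proof. by []. Qed.

(** Under the map s, the set U(e) of the Pierce spectrum pulls back to Max_D e;
    both families generate the topologies, on the side of Max_Z A by
    [separated_basis]. Injectivity is separation again, and a maximal
    congruence above a max-regular chi is mapped to chi by maximality of chi.
    *)
Lemma separated_s_homeomorphism : boolean_separated ->
  exists s : Max_Z A -> Sp A,
    (forall x, Sp_cong (s x) = s_cong (Max_cong x)) /\ homeomorphism s.
Proof.
move=> sepA.
pose s x : Sp A := SigSub (mem_set
  (s_cong_max_regular (Max_cong_prime x))).
have sE x : Sp_cong (s x) = s_cong (Max_cong x) by [].
have sU e : boolean_cong e -> s @^-1` Sp_U e = Max_D e.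
  move=> eb; apply/seteqP; split=> x ex ez; apply: ex.
  - by rewrite sE; apply: (iffRL (boolean_sub_s (Max_cong x) eb)).
  - by move: ez; rewrite sE => /(iffLR (boolean_sub_s (Max_cong x) eb)).
have sinj : injective s.
  move=> x y sxy; apply: Max_cong_inj; apply: contrapT => xy.
  have [e [eb ex ey]] := sepA _ _ (Max_cong_maximal x) (Max_cong_maximal y) xy.
  move: ey => /(prime_boolean (Max_cong_prime y) eb); apply.
  apply: (iffLR (boolean_sub_s _ eb)); rewrite -sE -sxy sE.
  exact: (iffRL (boolean_sub_s _ eb)).
have ssurj (chi : Sp A) : exists x, s x = chi.
  have [[S SB chiE] chiN chimax] : max_regular_cong (Sp_cong chi).
    exact: set_mem (valP chi).
  have [phi pm chip] := sub_maximal chiN.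
  have [x xphi] := Max_cong_surj pm; exists x; apply: val_inj.
  have [sr sN _] := set_mem (valP (s x)).
  apply: chimax => //; rewrite -/(Sp_cong (s x)) sE chiE.
  apply: sup_sub => e Se.
  apply: (iffRL (boolean_sub_s _ (SB _ Se))).
  by rewrite xphi; apply: subset_trans chip; rewrite chiE; exact: sub_sup.
have [_ bas] := separated_basis sepA.
exists s; split => //; split.
  apply/continuousP => U /Sp_open[D DS <-].
  rewrite preimage_bigcup; apply: bigcup_open => B /DS[E ES <-].
  rewrite preimage_bigcap bigcap_fset big_seq.
  apply: big_ind => [||e eE]; [exact: openT|exact: openI|].
  by rewrite sU; [exact: Max_D_open|exact/set_mem/ES].
pose g chi := projT1 (cid (ssurj chi)).
have gK : cancel g s by move=> chi; rewrite /g; case: cid.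
have sK : cancel s g by move=> x; apply: sinj; rewrite gK.
exists g; split => // chi U /bas[_ [[e eb <-] eg] eU].
apply: filterS (_ : nbhs chi (Sp_U e)) => [z|].
  by rewrite -{1}(gK z) => ez; apply: eU; rewrite -(sU _ eb).
apply: open_nbhs_nbhs; split; first exact: Sp_U_open.
by rewrite -(gK chi); move: eg; rewrite -(sU _ eb).
Qed.

End SemidegenerateModular.

Theorem theorem8p19 (sg : signature) (V : variety sg)
  (V_modular : congruence_modular V) (V_semidegenerate : semidegenerate V)
  (A : member V) (K_closed : compact_comm_closed A) (A_star : star_condition A) :
  [<-> (* (1) *) congruence_B_normal A;
       (* (2) *) forall phi psi : congruence A,
                   maximal_cong phi -> maximal_cong psi -> phi <> psi ->
                   exists alpha : congruence A,
                     [/\ boolean_cong alpha, alpha `<=` phi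
                       & perp alpha `<=` psi];
       (* (3) *) congruence_normal A /\ clopen_basis_space (Max_Z A);
       (* (4) *) congruence_normal A /\ boolean_space (Max_Z A);
       (* (5) *) basis [set Max_D alpha | alpha in @boolean_cong sg A];
       (* (6) *) exists s : Max_Z A -> Sp A,
                   (forall phi, Sp_cong (s phi) = s_cong (Max_cong phi)) /\
                   homeomorphism s;
       (* (7) *) congruence_normal A /\ totally_disconnected [set: Max_Z A];
       (* (8) *) forall phi psi : congruence A,
                   maximal_cong phi -> maximal_cong psi -> phi <> psi ->
                   exists alpha : congruence A,
                     [/\ boolean_cong alpha, alpha `<=` O_cong phi
                       & perp alpha `<=` O_cong psi]].
Proof.
have s12 := @B_normal_separated _ _ V_modular V_semidegenerate A.
have s21 := @separated_B_normal _ _ V_modular V_semidegenerate A.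
have s25 := @separated_basis _ _ V_modular V_semidegenerate A.
have s52 := @basis_separated _ _ V_modular V_semidegenerate A.
have s23 : boolean_separated A ->
    congruence_normal A /\ clopen_basis_space (Max_Z A).
  move=> sepA; split; first exact/B_normal_normal/s21.
  exact/basis_clopen/s25.
have s34 : congruence_normal A /\ clopen_basis_space (Max_Z A) ->
    congruence_normal A /\ boolean_space (Max_Z A).
  move=> [nA cb]; split => //; split => //; first exact: Max_Z_compact.
  exact: normal_hausdorff.
have s47 : congruence_normal A /\ boolean_space (Max_Z A) ->
    congruence_normal A /\ totally_disconnected [set: Max_Z A].
  move=> [nA [_ hM cb]]; split => //.
  apply: zero_dimension_totally_disconnected.
  exact: clopen_basis_zero_dimensional.
have s72 : congruence_normal A /\ totally_disconnected [set: Max_Z A] ->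
    boolean_separated A.
  move=> [nA td]; apply: zero_dimensional_separated => //.
  apply: totally_disconnected_zero_dimensional td; last exact: Max_Z_compact.
  exact: normal_hausdorff.
tfae => //.
- by move=> /s47/s72/s25.
- by move=> /s52; exact: separated_s_homeomorphism.
- move=> [s [sE [_ [g [sK _ _]]]]].
  have sepA : boolean_separated A.
    exact: (s_injective_separated V_modular V_semidegenerate sE (can_inj sK)).
  exact/s47/s34/s23.
- by move=> /s72; exact: separated_O.
- move=> sepO; apply: s21; exact: O_separated.
Qed.
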